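(* Let $r>s\ge 1$ be integers, let $H$ be an $(r-s)$-progressive-edge-critical graph with $\chi(H)=r+1$, and let $F$ be a core of $H$. Then there exists $n_0=n_0(H,r,s)$ such that the following holds for all $n\ge n_0$. Let $G$ be an $H$-free graph on $n$ vertices. Suppose that $G$ contains a set $M\subseteq V(G)$ of size $m$ such that $G[M]$ is $F$-free and \[ m\ge \left\lceil \frac{sn}{r}\right\rceil . \] Then \[ e(G)\le m(n-m)+t_s(m)+t_{r-s}(n-m). \] Moreover, equality holds if and only if $G$ is a complete $r$-partite graph whose parts can be divided into two groups: $s$ parts with total size $m$, as equal as possible, and $r-s$ parts with total size $n-m$, as equal as possible.
   Context: All graphs are finite, simple and undirected; $e(G)$ is the number of edges of $G$, $\chi$ is the chromatic number, and $G[M]$ is the subgraph induced by $M\subseteq V(G)$. A graph is $F$-free if it contains no (not necessarily induced) subgraph isomorphic to $F$. A graph is edge-critical if it contains an edge whose deletion reduces its chromatic number. For an integer $t\ge 0$, a graph $H$ is $t$-progressive-edge-critical if $H$ is edge-critical and there exist vertices $v_1,\ldots,v_t$ of $H$ such that, for each $1\le i\le t$, the graph $H-\{v_1,\ldots,v_i\}$ (vertex deletion) is edge-critical and has chromatic number $\chi(H)-i$. For such a sequence of vertices, the graph $H-\{v_1,\ldots,v_t\}$ is called a core of $H$; in the claim, cores are taken with $t=r-s$. A graph is complete $r$-partite if its vertex set can be partitioned into $r$ independent sets (parts) such that every two vertices from distinct parts are adjacent; parts of size zero are allowed. ''As equal as possible'' means that the sizes of any two parts within the group differ by at most one. The Turán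 graph $T_r(n)$ is the complete $r$-partite graph on $n$ vertices in which any two part sizes differ by at most one, and $t_r(n)=e(T_r(n))$, with $t_r(0)=0$. *)

(* Defs.v *)
From mathcomp Require Import all_boot.

Set Implicit Arguments.
Unset Strict Implicit.
Unset Printing Implicit Defensive.

Record sgraph := SGraph {
  vert :> finType;
  adj : rel vert;
  adj_sym : symmetric adj;
  adj_irr : irreflexive adj }.

Definition edges (G : sgraph) : {set {set G}} :=
  [set e | [exists x : G, exists y : G, adj x y && (e == [set x; y])]].

Definition num_edges (G : sgraph) : nat := #|edges G|.

Definition colorable (G : sgraph) (k : nat) : bool :=
  [exists c : {ffun G -> 'I_k},
    [forall x : G, forall y : G, adj x y ==> (c x != c y)]].

Lemma colorable_card (G : sgraph) : exists k, colorable G k.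
Proof.
exists #|G|; apply/existsP; exists [ffun x => enum_rank x].
apply/forallP => x; apply/forallP => y; rewrite !ffunE; apply/implyP => xy.
by apply/eqP => /enum_rank_inj exy; move: xy; rewrite exy adj_irr.
Qed.

Definition chi (G : sgraph) : nat := ex_minn (colorable_card G).

Section Induced.
Variables (G : sgraph) (M : {set G}).
Definition induced_adj : rel {x : G | x \in M} :=
  fun u v => adj (val u) (val v).
Lemma induced_sym : symmetric induced_adj.
Proof. by move=> u v; apply: adj_sym. Qed.
Lemma induced_irr : irreflexive induced_adj.
Proof. by move=> u; apply: adj_irr. Qed.
Definition induced : sgraph := SGraph induced_sym induced_irr.
End Induced.

Definition del_vertices (G : sgraph) (S : {set G}) : sgraph := induced (~: S).

Section DelEdge.
Variables (G : sgraph) (x y : G).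
Definition del_edge_adj : rel G :=
  fun u v => adj u v && ([set u; v] != [set x; y]).
Lemma del_edge_sym : symmetric del_edge_adj.
Proof. by move=> u v; rewrite /del_edge_adj adj_sym setUC. Qed.
Lemma del_edge_irr : irreflexive del_edge_adj.
Proof. by move=> u; rewrite /del_edge_adj adj_irr. Qed.
Definition del_edge : sgraph := SGraph del_edge_sym del_edge_irr.
End DelEdge.

Definition edge_critical (G : sgraph) : Prop :=
  exists x y : G, adj x y /\ chi (del_edge x y) < chi G.

(* The subgraph copy is not required to be induced. *)
Definition contains (G F : sgraph) : Prop :=
  exists f : F -> G, injective f /\ forall x y : F, adj x y -> adj (f x) (f y).

Definition is_free (F G : sgraph) : Prop := ~ contains G F.

(* The equation on chi forces the entries of vs to be pairwise distinct. *)
Definition progressive_seq (H : sgraph) (t : nat) (vs : t.-tuple H) : Prop :=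
  forall i, 1 <= i <= t ->
    let Hi := del_vertices [set x in take i vs] in
    edge_critical Hi /\ chi Hi + i = chi H.

Definition progressive_edge_critical (t : nat) (H : sgraph) : Prop :=
  edge_critical H /\ exists vs : t.-tuple H, progressive_seq vs.

Definition is_core (t : nat) (H F : sgraph) : Prop :=
  exists vs : t.-tuple H,
    progressive_seq vs /\ F = del_vertices [set x in vs].

(* The parts are the fibres of p; a part may be empty. *)
Definition part (G : sgraph) (r : nat) (p : G -> 'I_r) (i : 'I_r) : {set G} :=
  [set x | p x == i].

Definition complete_partite (G : sgraph) (r : nat) (p : G -> 'I_r) : Prop :=
  forall x y : G, adj x y = (p x != p y).

Definition as_equal_as_possible (G : sgraph) (r : nat) (p : G -> 'I_r)
    (A : {set 'I_r}) : Prop :=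
  forall i j, i \in A -> j \in A -> #|part p i| <= #|part p j| + 1.

(* Vertices i and j lie in the same part iff they are congruent modulo r;
   turan_balanced below shows that this is the balanced r-partite graph. *)
Section Turan.
Variables (r n : nat).
Definition turan_adj : rel 'I_n := fun i j => i %% r != j %% r.
Lemma turan_sym : symmetric turan_adj.
Proof. by move=> i j; rewrite /turan_adj eq_sym. Qed.
Lemma turan_irr : irreflexive turan_adj.
Proof. by move=> i; rewrite /turan_adj eqxx. Qed.
Definition turan : sgraph := SGraph turan_sym turan_irr.
End Turan.

Lemma card_residue (r n k : nat) : k < r ->
  #|[set i : 'I_n | i %% r == k]| = n %/ r + (k < n %% r).
Proof.
move=> kr; have r_gt0 : 0 < r by apply: leq_ltn_trans kr.
rewrite cardsE -sum1_card big_mkcond /= -(big_mkord xpredT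
  (fun i => if i \in [pred i | i %% r == k] then 1 else 0)).
elim: n => [|n IHn]; first by rewrite big_geq // div0n mod0n.
rewrite big_nat_recr //= IHn inE divnS // modnS.
have := ltn_pmod n r_gt0.
have -> : (r %| n.+1) = ((n %% r).+1 == r).
  rewrite {1}(divn_eq n r) -addnS dvdn_addr ?dvdn_mull //.
  apply/idP/eqP => [/(dvdn_leq (ltn0Sn _)) le|->//].
  by apply/eqP; rewrite eqn_leq le ltn_pmod.
case: (eqVneq (n %% r).+1 r) => [e _|ne lt]; last first.
  by rewrite add0n ltnS; case: ltngtP => _ /=; rewrite ?addn0.
rewrite /= addn0; have : k <= n %% r by rewrite -ltnS e.
by case: ltngtP => // _ _; rewrite ?addn0 ?addn1 ?add1n.
Qed.

Lemma turan_balanced (r n : nat) : 0 < r ->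
  exists p : turan r n -> 'I_r,
    complete_partite p /\ as_equal_as_possible p [set: 'I_r].
Proof.
move=> r0; exists (fun i : 'I_n => Ordinal (ltn_pmod i r0)); split=> //.
move=> i j _ _.
have cardE (k : 'I_r) :
    #|part (fun i : turan r n => Ordinal (ltn_pmod (i : 'I_n) r0)) k|
    = n %/ r + (k < n %% r) by rewrite -card_residue.
rewrite !cardE -addnA leq_add2l.
by do 2!case: (_ < _).
Qed.

Definition t_ (r n : nat) : nat := num_edges (turan r n).

(* Main.v *)
Require Import Defs.
From mathcomp Require Import all_boot all_order all_algebra.
From mathcomp Require Import perm zify.

Set Implicit Arguments.
Unset Strict Implicit.
Unset Printing Implicit Defensive.

(* Put k = r - s and let K_s^+(t) be the complete s-partite graph with parts of
   size t, together with an edge inside one part.  For large t the core F is a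
   subgraph of K_s^+(t), and H is a subgraph of the join of K_k and K_s^+(t); so
   only these two graphs matter.  All bounds are stated for twice the number of
   edges, which for a complete multipartite graph on n vertices is n^2 minus the
   sum of the squares of the part sizes.

   For M = V(G) and k = 0 the bound is Simonovits' theorem on edge-critical
   graphs.  In general, deleting a vertex of M with noticeably more than m/s
   non-neighbours, or a vertex outside M with noticeably more than (n-m)/k,
   increases the excess over the bound, so only graphs without such vertices need
   be considered, or graphs where m exceeds sn/r by less than 1, to which
   Simonovits' theorem applies.  If m/s
   and n/r are nearly equal, then G has minimum degree close to (1-1/r)n, hence
   is r-colourable, and M lies in the union of s colour classes.  Otherwise the
   minimum-degree form of the Erdos-Stone theorem, in the common neighbourhood
   of a (k+1)-clique outside M, shows that there is no such clique; one adds
   Simonovits' bound on M, Turan's bound outside M, and m(n-m). *)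

(** * Degree sums and colour classes *)

Lemma card_bigcup_le (I T : finType) (P : pred I) (F : I -> {set T}) :
  #|\bigcup_(i | P i) F i| <= \sum_(i | P i) #|F i|.
Proof.
elim/big_rec2: _ => [|i B a _ le]; first by rewrite cards0.
by rewrite (leq_trans (leq_card_setU _ _)) // leq_add2l.
Qed.

Lemma sum_setT (I : finType) (F : I -> nat) : \sum_(i in [set: I]) F i = \sum_i F i.
Proof. by apply: eq_bigl => i; rewrite inE. Qed.

Lemma subset_of_card (T : finType) (A : {set T}) n :
  n <= #|A| -> exists2 B : {set T}, B \subset A & #|B| = n.
Proof.
move=> /card_geqP[s [us <- sA]]; exists [set x in s].
  by apply/subsetP => x; rewrite inE => /sA.
by rewrite cardsE; apply/card_uniqP.
Qed.

Section Neighbourhoods.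
Variable G : sgraph.
Implicit Types (U V M : {set G}) (x y u v : G).

Lemma sum_setU U V (F : G -> nat) : [disjoint U & V] ->
  \sum_(x in U :|: V) F x = \sum_(x in U) F x + \sum_(x in V) F x.
Proof. by move=> dUV; rewrite -bigU //; apply: eq_bigl => x; rewrite !inE. Qed.

Definition nb U x : {set G} := [set y in U | adj x y].
Definition non U x : {set G} := [set y in U | ~~ adj x y].
Definition degsum U : nat := \sum_(x in U) #|nb U x|.

Lemma nb_sub U x : nb U x \subset U.
Proof. by apply/subsetP => y; rewrite inE => /andP[]. Qed.

Lemma nbS U V x : U \subset V -> nb U x \subset nb V x.
Proof.
move=> sUV; apply/subsetP => y; rewrite !inE => /andP[yU ->].
by rewrite (subsetP sUV).
Qed.

Lemma nonS U V x : U \subset V -> non U x \subset non V x.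
Proof.
move=> sUV; apply/subsetP => y; rewrite !inE => /andP[yU ->].
by rewrite (subsetP sUV).
Qed.

Lemma card_nb_non U x : #|nb U x| + #|non U x| = #|U|.
Proof.
rewrite -[RHS](cardsID [set y | adj x y]); congr (_ + _).
  by apply: eq_card => y; rewrite !inE.
by apply: eq_card => y; rewrite !inE andbC.
Qed.

Lemma card_nbE U x : #|nb U x| = \sum_(y in U) adj x y.
Proof.
rewrite -sum1_card big_mkcond [RHS]big_mkcond; apply: eq_bigr => y _.
by rewrite inE; case: (y \in U); case: (adj x y).
Qed.

Lemma card_nonE U x : #|non U x| = \sum_(y in U) ~~ adj x y.
Proof.
rewrite -sum1_card big_mkcond [RHS]big_mkcond; apply: eq_bigr => y _.
by rewrite inE; case: (y \in U); case: (adj x y).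
Qed.

Lemma nb_exchange U V : \sum_(x in U) #|nb V x| = \sum_(y in V) #|nb U y|.
Proof.
under eq_bigr do rewrite card_nbE.
rewrite exchange_big /=; apply: eq_bigr => y _; rewrite card_nbE.
by apply: eq_bigr => x _; rewrite adj_sym.
Qed.

Lemma non_exchange U V : \sum_(x in U) #|non V x| = \sum_(y in V) #|non U y|.
Proof.
under eq_bigr do rewrite card_nonE.
rewrite exchange_big /=; apply: eq_bigr => y _; rewrite card_nonE.
by apply: eq_bigr => x _; rewrite adj_sym.
Qed.

Lemma nbU U V x : [disjoint U & V] -> #|nb (U :|: V) x| = #|nb U x| + #|nb V x|.
Proof. by move=> dUV; rewrite !card_nbE sum_setU. Qed.

Lemma degsumU U V : [disjoint U & V] ->
  degsum (U :|: V) = degsum U + degsum V + 2 * \sum_(x in U) #|nb V x|.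
Proof.
move=> dUV; rewrite /degsum !sum_setU //=.
rewrite !(eq_bigr _ (fun x _ => nbU x dUV)) !big_split /= (nb_exchange V U); lia.
Qed.

Lemma degsumD1 U v : v \in U -> degsum U = degsum (U :\ v) + 2 * #|nb U v|.
Proof.
move=> vU; rewrite -{1}(setD1K vU) degsumU; last first.
  by rewrite disjoints1 !inE eqxx.
have nb_v : nb U v = nb (U :\ v) v.
  apply/setP => y; rewrite !inE; case: eqVneq => //= ->.
  by rewrite adj_irr andbF.
rewrite big_set1 /degsum big_set1 -nb_v.
suff -> : nb [set v] v = set0 by rewrite cards0.
by apply/setP => y; rewrite !inE; case: eqVneq => //= ->; rewrite adj_irr.
Qed.

Lemma degsum_le U : degsum U <= #|U| ^ 2.
Proof.
rewrite /degsum -mulnn -sum_nat_const; apply: leq_sum => x _.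
exact: subset_leq_card (nb_sub _ _).
Qed.

(** Colours are natural numbers, bounded on U only, so that a colouring can be restricted, shifted
    or glued to another one without casts. *)
Definition proper_on U (r : nat) (p : G -> nat) : Prop :=
  (forall x, x \in U -> p x < r) /\
  (forall x y, x \in U -> y \in U -> adj x y -> p x != p y).

Definition complete_on U (p : G -> nat) : Prop :=
  forall x y, x \in U -> y \in U -> adj x y = (p x != p y).

Definition cls U (p : G -> nat) (i : nat) : {set G} := [set x in U | p x == i].

Lemma sum_cls U r p (F : G -> nat) : (forall x, x \in U -> p x < r) ->
  \sum_(i < r) \sum_(x in cls U p i) F x = \sum_(x in U) F x.
Proof.
move=> p_lt; case: r p_lt => [|r] p_lt.
  rewrite big_ord0 big_pred0 // => x; apply/negP => /p_lt; lia.
rewrite (partition_big (fun x => inord (p x) : 'I_r.+1) xpredT) //=.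
apply: eq_bigr => i _; apply: eq_bigl => x; rewrite inE.
case xU: (x \in U) => //=.
by rewrite -val_eqE /= inordK // p_lt.
Qed.

Lemma card_cls U r p : (forall x, x \in U -> p x < r) ->
  \sum_(i < r) #|cls U p i| = #|U|.
Proof.
move=> p_lt; rewrite -sum1_card -(sum_cls _ p_lt).
by apply: eq_bigr => i _; rewrite sum1_card.
Qed.

Lemma sqr_cls U r p : (forall x, x \in U -> p x < r) ->
  \sum_(i < r) #|cls U p i| ^ 2 = \sum_(x in U) \sum_(y in U) (p x == p y).
Proof.
move=> p_lt; rewrite -(sum_cls _ p_lt); apply: eq_bigr => i _.
rewrite -mulnn -sum_nat_const; apply: eq_bigr => x; rewrite inE => /andP[_ /eqP ->].
rewrite -sum1_card big_mkcond [RHS]big_mkcond; apply: eq_bigr => y _.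
by rewrite inE eq_sym; case: (y \in U); case: (i == p y :> nat).
Qed.

(** Among the ordered pairs of U, the adjacent ones and those inside a class are disjoint; equality
    means that together they are all pairs. *)
Lemma proper_degsum U r p : proper_on U r p ->
  degsum U + \sum_(i < r) #|cls U p i| ^ 2 <= #|U| ^ 2 /\
  (degsum U + \sum_(i < r) #|cls U p i| ^ 2 = #|U| ^ 2 -> complete_on U p).
Proof.
move=> [p_lt p_pr]; rewrite (sqr_cls p_lt) /degsum -big_split /=.
have sq : #|U| ^ 2 = \sum_(x in U) \sum_(y in U) 1.
  by rewrite !sum_nat_const muln1 mulnn.
have le1 x : x \in U -> #|nb U x| + \sum_(y in U) (p x == p y) <=
    \sum_(y in U) 1 ?= iff [forall (y | y \in U), adj x y + (p x == p y) == 1].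
  move=> xU; rewrite card_nbE -big_split /=; apply: leqif_sum => y yU.
  split=> //; have := p_pr x y xU yU.
  by case: (adj x y) => [/(_ isT)/negPf->|_] //; case: (p x == p y).
have := leqif_sum (fun x => le1 x); rewrite -sq => -[le eqv]; split=> // /eqP.
rewrite eqv => /forall_inP all1 x y xU yU; have /forall_inP/(_ y yU) := all1 x xU.
by case: (adj x y); case: (p x == p y).
Qed.

Lemma complete_degsum U r p : (forall x, x \in U -> p x < r) ->
  complete_on U p -> degsum U + \sum_(i < r) #|cls U p i| ^ 2 = #|U| ^ 2.
Proof.
move=> p_lt p_c; rewrite (sqr_cls p_lt) /degsum -big_split /=.
rewrite -mulnn -sum_nat_const; apply: eq_bigr => x xU.
rewrite card_nbE -big_split /= -sum1_card; apply: eq_bigr => y yU.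
by rewrite p_c //; case: eqP.
Qed.

End Neighbourhoods.

(** * Complete multipartite subgraphs *)

Section Blowups.
Variable G : sgraph.
Implicit Types (U V M : {set G}) (x y u v : G).

Definition blowup q (X : 'I_q -> {set G}) : Prop :=
  forall i j, i != j -> forall x y, x \in X i -> y \in X j -> adj x y.

Definition has_blowup q t U : Prop :=
  exists2 X : 'I_q -> {set G}, blowup X & forall i, X i \subset U /\ t <= #|X i|.

(* A large complete q-partite graph together with an edge u v that behaves as
   if it lay inside part i0. *)
Definition has_plus q t U : Prop :=
  exists (X : 'I_q -> {set G}) (i0 : 'I_q) (u v : G),
    [/\ blowup X, forall i, X i \subset U /\ t <= #|X i|,
        [/\ u \in U, v \in U & adj u v] &
        forall j, j != i0 -> forall x, x \in X j -> adj u x /\ adj v x].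

Lemma blowup_sub q (X Y : 'I_q -> {set G}) :
  blowup Y -> (forall i, X i \subset Y i) -> blowup X.
Proof.
by move=> bY sXY i j ij x y /(subsetP (sXY i)) xi /(subsetP (sXY j)); apply: bY xi.
Qed.

Lemma has_plus_sub q t U V : U \subset V -> has_plus q t U -> has_plus q t V.
Proof.
move=> sUV [X [i0 [u [v [bX X_U [uU vU uv] uvX]]]]].
exists X, i0, u, v; split=> //; first move=> i.
  by have [sXU ->] := X_U i; rewrite (subset_trans sXU).
by split; rewrite ?(subsetP sUV).
Qed.

(** The vertex x sees every part, so an edge from x to a vertex of part [ord0] acts as the edge
    inside that part. *)
Lemma blowup_nb_plus q t U x : 0 < q -> 0 < t -> x \in U ->
  has_blowup q t (nb U x) -> has_plus q t U.
Proof.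
case: q => // q _ t0 xU [X bX X_U].
have [sX0 tX0] := X_U ord0.
have /card_gt0P[v vX0] : 0 < #|X ord0| by apply: leq_trans tX0.
have := subsetP sX0 v vX0; rewrite inE => /andP[vU xv].
exists X, ord0, x, v; split=> //.
  by move=> i; have [sXi ->] := X_U i; rewrite (subset_trans sXi) ?nb_sub.
move=> j j0 y yX; split; last by apply: (bX ord0 j) => //; rewrite eq_sym.
by have [/subsetP/(_ y yX)] := X_U j; rewrite inE => /andP[].
Qed.

Definition common_nb U V : {set G} := [set y in U | [forall x in V, adj x y]].

Lemma common_nb_sub U V : common_nb U V \subset U.
Proof. by apply/subsetP => y; rewrite inE => /andP[]. Qed.

Lemma common_nbP U V x y : x \in V -> y \in common_nb U V -> adj x y.
Proof. by move=> xV; rewrite inE => /andP[_ /forall_inP/(_ x xV)]. Qed.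

Lemma card_common_nb U V : #|U| <= #|common_nb U V| + \sum_(x in V) #|non U x|.
Proof.
rewrite -(cardsID (common_nb U V) U) (setIidPr (common_nb_sub U V)) leq_add2l.
apply: (@leq_trans #|\bigcup_(x in V) non U x|).
  apply: subset_leq_card; apply/subsetP => y; rewrite !inE => /andP[nc yU].
  move: nc; rewrite yU /= negb_forall_in => /exists_inP[x xV nxy].
  by apply/bigcupP; exists x; rewrite // inE yU.
elim/big_rec2: _ => [|x a B _ le]; first by rewrite cards0.
by rewrite (leq_trans (leq_card_setU _ _)) ?leq_add2l.
Qed.

Definition extend q (X : 'I_q -> {set G}) (C : {set G}) (j : 'I_q.+1) : {set G} :=
  oapp X C (unlift ord0 j).

Lemma extend_blowup q (X : 'I_q -> {set G}) (C : {set G}) : blowup X ->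
  (forall i x y, x \in X i -> y \in C -> adj x y) -> blowup (extend X C).
Proof.
move=> bX XC i j; rewrite /extend.
case: unliftP => [i' ->|->]; case: unliftP => [j' ->|->] //=.
- by rewrite (inj_eq lift_inj) => /bX.
- by move=> _ x y /XC; apply.
- by move=> _ x y xC yX; rewrite adj_sym; exact: XC yX xC.
Qed.

(** Any t vertices of the first part exclude at most t * eta vertices from each other part. A part
    suffers this at most q times and must still have t vertices at the end. *)
Lemma greedy_blowup t eta q (Y : 'I_q -> {set G}) :
    (forall i, q * (t * eta) + t <= #|Y i|) ->
    (forall i j, i != j -> forall y, y \in Y i -> #|non (Y j) y| <= eta) ->
  exists2 X : 'I_q -> {set G}, blowup X & forall i, X i \subset Y i /\ #|X i| = t.
Proof.
elim: q Y => [|q IHq] Y Y_big Y_non; first by exists (fun _ => set0) => -[].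
have [|C sCY cC] := @subset_of_card _ (Y ord0) t.
  by apply: leq_trans (Y_big _); rewrite leq_addl.
pose Y' i := common_nb (Y (lift ord0 i)) C.
have [||X bX X_Y'] := IHq Y'.
- move=> i; have := card_common_nb (Y (lift ord0 i)) C.
  have : \sum_(x in C) #|non (Y (lift ord0 i)) x| <= t * eta.
    rewrite -cC -sum_nat_const; apply: leq_sum => x xC.
    by apply: (Y_non ord0) => //; rewrite (subsetP sCY).
  have := Y_big (lift ord0 i); rewrite /Y'; lia.
- move=> i j ij y yY; apply: leq_trans (Y_non (lift ord0 i) (lift ord0 j) _ y _).
  + exact: subset_leq_card (nonS _ (common_nb_sub _ _)).
  + by rewrite (inj_eq lift_inj).
  + exact: subsetP (common_nb_sub _ _) _ yY.
exists (extend X C).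
  apply: extend_blowup => // i x y xX yC; rewrite adj_sym.
  apply: common_nbP yC _; exact: subsetP (X_Y' i).1 x xX.
move=> i; rewrite /extend; case: unliftP => [j ->|->] //=.
have [sX ->] := X_Y' j; split=> //.
exact: subset_trans sX (common_nb_sub _ _).
Qed.

End Blowups.

(* L measures the slack: q D <= (1 - 1/L) |U|. *)
Lemma erdos_stone L q t : exists n0,
  forall (G : sgraph) (U : {set G}) D, n0 <= #|U| ->
  (forall x, x \in U -> #|non U x| <= D) -> L * (q * D) + #|U| <= L * #|U| ->
  has_blowup q.+1 t U.
Proof.
elim: q t => [|q IHq] t.
  exists t => G U D tU _ _; exists (fun _ => U) => // i j.
  by rewrite [i]ord1 [j]ord1.
(* With this T, the fraction of vertices having fewer than t neighbours in some part is at most (1 -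
   1/L) T / (T - t) = (2L - 2) / (2L - 1) < 1. *)
pose T := 2 * t * L.
have [n0 IH] := IHq T.
exists (n0 + 2 * L * (t * 2 ^ (q.+1 * T))).+1 => G U D Ubig U_non LD.
have [|//||X0 bX0 X0_U] := IH G U D; try nia.
have /fin_all_exists2[X sX cX] i : exists2 B : {set G}, B \subset X0 i & #|B| = T.
  by apply: subset_of_card; case: (X0_U i).
have {bX0}bX : blowup X := blowup_sub bX0 sX.
have {X0 X0_U sX}sX i : X i \subset U := subset_trans (sX i) (X0_U i).1.
pose good := [set y in U | [forall i, t <= #|nb (X i) y|]].
(* A vertex outside [good] misses more than T - t vertices of some part, while each vertex of the
   parts is missed by at most D. *)
have bad_le : #|U :\: good| * (T - t) <= q.+1 * (T * D).
  rewrite -sum_nat_const.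
  apply: (@leq_trans (\sum_(y in U) \sum_i #|non (X i) y|)).
    rewrite [X in _ <= X](big_setID good) /= addnC; apply: leq_trans (leq_addr _ _).
    apply: leq_sum => y; rewrite !inE => /andP[nb_y yU]; move: nb_y.
    rewrite yU /= negb_forall => /existsP[i]; rewrite (bigD1 i) //=.
    by have := card_nb_non (X i) y; rewrite cX; lia.
  rewrite exchange_big /= -[X in _ <= X * _]card_ord -sum_nat_const; apply: leq_sum => i _.
  rewrite non_exchange -(cX i) -sum_nat_const; apply: leq_sum => x xX.
  by apply: U_non; apply: subsetP (sX i) x xX.
have goodE : #|U| = #|good| + #|U :\: good|.
  rewrite -(cardsID good U) (setIidPr _) //.
  by apply/subsetP => y; rewrite inE => /andP[].
have [t0|t_gt0] := posnP t.
  exists (fun _ => set0) => [i j _ x y|i]; rewrite ?inE //.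
  by rewrite sub0set t0.
have good_big : t * 2 ^ (q.+1 * T) < #|good|.
  suff : #|U| <= 2 * L * #|good| by nia.
  have : L * (#|U :\: good| * (T - t)) <= T * (L * #|U| - #|U|).
    apply: leq_trans (_ : T * (L * (q.+1 * D)) <= _); first by nia.
    by rewrite leq_mul2l; lia.
  rewrite /T goodE; move: #|good| #|U :\: good| => g b.
  have L_gt0 : 0 < L by nia.
  have -> : 2 * t * L - t = t * (2 * L - 1) by nia.
  have -> : L * (b * (t * (2 * L - 1))) = (t * L) * (b * (2 * L - 1)) by nia.
  have -> : 2 * t * L * (L * (g + b) - (g + b)) = (t * L) * (2 * (L - 1) * (g + b)).
    by nia.
  rewrite leq_pmul2l ?muln_gt0 ?t_gt0 //; nia.
pose W := \bigcup_i X i.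
have cW : #|W| <= q.+1 * T.
  apply: leq_trans (card_bigcup_le _ _) _.
  by rewrite (eq_bigr _ (fun i _ => cX i)) sum_nat_const card_ord.
(* Pigeonhole on the subsets of W: some t good vertices have the same trace Z. They form the new
   part, and the old parts are cut down to Z, which keeps t vertices in each. *)
have [Z Zbig] : exists Z, t <= #|[set y in good | nb W y == Z]|.
  apply/existsP; apply: contraLR good_big; rewrite negb_exists => /forallP all_lt.
  rewrite -leqNgt -sum1_card (partition_big (nb W) (mem (powerset W))) /=; last first.
    by move=> y _; rewrite inE nb_sub.
  apply: (@leq_trans (\sum_(Z in powerset W) t)).
    apply: leq_sum => Z _; have := all_lt Z; rewrite -ltnNge => /ltnW.
    by rewrite -sum1_card; apply: leq_trans; rewrite leq_eqVlt; apply/orP; left;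
       apply/eqP; apply: eq_bigl => y; rewrite !inE.
  by rewrite sum_nat_const card_powerset mulnC leq_mul2l leq_pexp2l ?orbT.
pose C := [set y in good | nb W y == Z].
have [y0] : exists y0, y0 \in C by apply/card_gt0P; apply: leq_trans Zbig.
rewrite inE => /andP[y0g /eqP y0Z].
exists (extend (fun i => X i :&: Z) C).
  apply: extend_blowup; first by apply: (blowup_sub bX) => i; apply: subsetIl.
  move=> i x y; rewrite !inE => /andP[_ xZ] /andP[_ /eqP yZ].
  by move: xZ; rewrite -yZ inE adj_sym => /andP[].
move=> i; rewrite /extend; case: unliftP => [j _|_] /=; last first.
  split=> //; apply/subsetP => y; rewrite !inE => /andP[/andP[-> _] _] //.
split; first exact: subset_trans (subsetIl _ _) (sX j).
move: y0g; rewrite inE => /andP[_ /forallP/(_ j)] /leq_trans; apply.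
apply: subset_leq_card; apply/subsetP => x; rewrite -y0Z !inE => /andP[xX ->].
by rewrite xX /= andbT; apply/bigcupP; exists j.
Qed.

(** * Stability *)

Lemma card_nonU (G : sgraph) (U V W : {set G}) x :
  U :|: V \subset W -> [disjoint U & V] -> #|non U x| + #|non V x| <= #|non W x|.
Proof.
move=> sUVW dUV; have <- : #|non (U :|: V) x| = #|non U x| + #|non V x|.
  by rewrite !card_nonE sum_setU.
exact: subset_leq_card (nonS _ sUVW).
Qed.

Lemma indep_sub_non (G : sgraph) (U V : {set G}) x : V \subset U ->
  (forall y, y \in V -> ~~ adj x y) -> V \subset non U x.
Proof.
by move=> sVU V_non; apply/subsetP => y yV; rewrite inE (subsetP sVU) ?V_non.
Qed.

(* A vertex misses almost all of some part of a large complete r-partite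
   subgraph X.  Counting the pairs missed by X shows that most vertices miss
   little of the other parts; they form independent sets Y i of size about |U|/r,
   and every vertex has few neighbours in some Y i, which gives its colour. *)
Lemma plus_free_colorable r t : 0 < r -> 0 < t -> exists L n0,
  forall (G : sgraph) (U : {set G}) D,
  n0 <= #|U| -> (forall x, x \in U -> #|non U x| <= D) ->
  L * (r * D) <= L.+1 * #|U| -> ~ has_plus r t U -> exists p, proper_on U r p.
Proof.
(* All errors below are multiples of d, which is |U| / L rounded down; L is so large that even the
   errors of order r * t * d stay below the part size of about |U| / r. *)
move=> r_gt0 t_gt0; pose L := 50 * (r * r * t); pose T := 8 * t * L.
have L50 : 50 <= L by rewrite /L; nia.
have T50 : 8 * t <= T by rewrite /T; nia.
have [n0 ES] := erdos_stone (2 * r) r.-1 T.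
exists L, (n0 + L) => G U D Ubig U_non LD noplus.
have := divn_eq #|U| L; have := ltn_pmod #|U| (leq_trans (isT : 0 < 50) L50).
set d := #|U| %/ L; set e := #|U| %% L => eL nE.
have d_gt0 : 0 < d by rewrite divn_gt0; lia.
pose w := r * r * (t * d); have dL : d * L = 50 * w by rewrite /L /w; lia.
have d_w : d <= r * t * d by rewrite leq_pmull // muln_gt0 r_gt0.
have w_r : r * (r * t * d) = w by rewrite /w; lia.
have rD : r * D <= #|U| + d.
  rewrite leqNgt; apply/negP => lt; have : L * (#|U| + d).+1 <= L * (r * D).
    by rewrite leq_pmul2l //; lia.
  lia.
have [|//||X0 bX0 X0_U] := ES G U D; first lia.
  have -> : 2 * r * (r.-1 * D) = 2 * r.-1 * (r * D) by lia.
  apply: (@leq_trans (2 * r.-1 * (#|U| + d) + #|U|)).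
    by rewrite leq_add2r leq_mul2l rD orbT.
  have : r.-1 * d <= w by rewrite -w_r leq_mul ?leq_pred.
  have : 2 * r * #|U| = 2 * r.-1 * #|U| + 2 * #|U| by rewrite -{1}(prednK r_gt0); lia.
  lia.
rewrite prednK // in X0 bX0 X0_U.
have /fin_all_exists2[X sX cX] i : exists2 B : {set G}, B \subset X0 i & #|B| = T.
  by apply: subset_of_card; case: (X0_U i).
have {bX0}bX : blowup X := blowup_sub bX0 sX.
have {X0 X0_U sX}sX i : X i \subset U := subset_trans (sX i) (X0_U i).1.
have few y : y \in U -> exists i, #|nb (X i) y| < t.
  move=> yU; case: (boolP [exists i, #|nb (X i) y| < t]) => [/existsP//|].
  rewrite negb_exists => /forallP nb_big; case: noplus; apply: (blowup_nb_plus _ _ yU) => //.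
  exists (fun i => nb (X i) y); first by apply: (blowup_sub bX) => i; apply: nb_sub.
  by move=> i; rewrite nbS //; have := nb_big i; rewrite -leqNgt.
pose Y i := [set y in U | (#|nb (X i) y| < t) &&
  [forall j, (j != i) ==> (4 * #|non (X j) y| <= T)]].
have sY i : Y i \subset U by apply/subsetP => y; rewrite inE => /andP[].
have Y_far i j y : y \in Y i -> j != i -> 4 * #|non (X j) y| <= T.
  by rewrite inE => /and3P[_ _ /forallP/(_ j)/implyP]; apply.
(* Adjacent u and v in Y i share at least half of every other X j, hence t vertices; together with X
   i these give [has_plus]. *)
have Y_indep i u v : u \in Y i -> v \in Y i -> ~~ adj u v.
  move=> uY vY; apply/negP => uv; apply: noplus.
  exists (fun j => if j == i then X i else nb (nb (X j) u) v), i, u, v; split.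
  - apply: (blowup_sub bX) => j; case: eqP => [->|_] //.
    exact: subset_trans (nb_sub _ _) (nb_sub _ _).
  - move=> j; case: eqP => [_|/eqP ji]; first by rewrite sX cX; lia.
    split; first exact: subset_trans (nb_sub _ _) (subset_trans (nb_sub _ _) (sX j)).
    have := card_nb_non (X j) u; have := card_nb_non (nb (X j) u) v.
    have := subset_leq_card (nonS v (nb_sub (X j) u)); rewrite cX.
    have := Y_far _ _ _ uY ji; have := Y_far _ _ _ vY ji; lia.
  - by rewrite !(subsetP (sY i)).
  - by move=> j /negPf->; move=> x; rewrite !inE => /andP[/andP[_ ->]].
have Y_disj i j : i != j -> [disjoint Y i & Y j].
  move=> ij; apply/pred0P => y /=; apply/negP => /andP[yi yj].
  have := Y_far _ _ _ yj ij; have := card_nb_non (X i) y; rewrite cX.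
  move: yi; rewrite inE => /and3P[_ lt _]; lia.
have Y_le i : #|Y i| <= D.
  have [->|[y yY]] := set_0Vmem (Y i); first by rewrite cards0.
  apply: leq_trans (U_non y _); last by rewrite (subsetP (sY i)).
  by apply/subset_leq_card/indep_sub_non => // z zY; apply: Y_indep yY zY.
have Y_cover : #|U| <= \sum_i #|Y i| + 5 * d.
  pose Z := U :\: \bigcup_i Y i.
  have : #|U| <= \sum_i #|Y i| + #|Z|.
    rewrite -(cardsID (\bigcup_i Y i) U) leq_add2r.
    apply: leq_trans (subset_leq_card (subsetIr _ _)) _.
    exact: card_bigcup_le.
  suff : #|Z| <= 5 * d by lia.
  (* Every vertex of U misses at least T - t vertices of X, and one in no Y i misses T / 4 more. At
     most r * T * D pairs are missed in all, which bounds Z. *)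
  have miss_ge y : y \in U ->
      4 * (T - t) + (y \in Z) * T <= 4 * \sum_i #|non (X i) y|.
    move=> yU; have [i lt_i] := few y yU; rewrite (bigD1 i) //=.
    have := card_nb_non (X i) y; rewrite cX => cXi.
    case yZ: (y \in Z); last by lia.
    have [j ji lt_j] : exists2 j, j != i & T < 4 * #|non (X j) y|.
      case: (boolP [exists (j | j != i), T < 4 * #|non (X j) y|]) => [/exists_inP//|].
      rewrite negb_exists_in => /forall_inP all_le.
      move: yZ; rewrite inE yU andbT => /bigcupP[]; exists i => //.
      rewrite inE yU lt_i; apply/forallP => j; apply/implyP => /all_le.
      by rewrite -leqNgt.
    by rewrite (bigD1 j) //=; lia.
  have : #|U| * (4 * (T - t)) + #|Z| * T <= 4 * (T * (r * D)).
    have -> : 4 * (T * (r * D)) = 4 * \sum_(i < r) \sum_(x in X i) D.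
      rewrite (eq_bigr (fun=> T * D)) => [|i _]; last by rewrite sum_nat_const cX.
      by rewrite sum_nat_const card_ord; lia.
    apply: (@leq_trans (4 * \sum_(i < r) \sum_(x in X i) #|non U x|)); last first.
      rewrite leq_mul2l; apply: leq_sum => i _; apply: leq_sum => x xX.
      by apply: U_non; apply: subsetP (sX i) x xX.
    have -> : #|Z| = \sum_(y in U) (y \in Z).
      rewrite -sum1_card big_mkcond [RHS]big_mkcond; apply: eq_bigr => y _.
      by rewrite inE; case: (y \in U); rewrite ?andbF ?andbT //; case: (_ \notin _).
    rewrite -sum_nat_const big_distrl -big_split /=.
    under [in X in _ <= X]eq_bigr do rewrite -non_exchange.
    rewrite exchange_big big_distrr /=; exact: leq_sum.
  have : T * (r * D) <= T * (#|U| + d) by rewrite leq_mul2l rD orbT.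
  have -> : T * (#|U| + d) = t * (8 * L * (#|U| + d)) by rewrite /T; lia.
  have -> : #|U| * (4 * (T - t)) = t * (#|U| * (4 * (8 * L - 1))).
    by rewrite (_ : T - t = t * (8 * L - 1)) /T; lia.
  have -> : #|Z| * T = t * (#|Z| * (8 * L)) by rewrite /T; lia.
  move: #|Z| (T * (r * D)) => z x x_le le.
  have : t * (#|U| * (4 * (8 * L - 1)) + z * (8 * L)) <= t * (32 * L * (#|U| + d)) by lia.
  rewrite leq_pmul2l // mulnBr mulnBr => {le x_le} le.
  rewrite -(@leq_pmul2l L) ?(leq_trans _ L50) //.
  have : #|U| < 2 * (d * L) by have := leq_pmull L d_gt0; lia.
  have : #|U| * (4 * 1) <= #|U| * (4 * (8 * L)) by rewrite leq_mul2l; lia.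
  lia.
(* The other r - 1 sets have at most D vertices each, 5 d vertices are uncovered, and r * D exceeds
   |U| by at most d. *)
have Y_ge i : D <= #|Y i| + 6 * d.
  have : \sum_i #|Y i| <= #|Y i| + r.-1 * D.
    rewrite (bigD1 i) //= leq_add2l.
    have -> : r.-1 = #|[pred j | j != i]|.
      by have := cardC1 i; rewrite card_ord => <-; apply: eq_card.
    by rewrite -sum_nat_const; apply: leq_sum.
  have : r * D = D + r.-1 * D by rewrite -mulSn prednK.
  lia.
(* The vertex y misses all of Y i, which leaves at most 6 d of its D permitted non-neighbours for Y
   j. *)
have Y_non i j y : i != j -> y \in Y i -> #|non (Y j) y| <= 6 * d.
  move=> ij yY; have yU := subsetP (sY i) _ yY.
  have : #|non (Y i) y| = #|Y i|.
    apply/eqP; rewrite eqn_leq subset_leq_card /=; last first.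
      by apply/subsetP => z; rewrite inE => /andP[].
    by apply/subset_leq_card/indep_sub_non => // z; apply: Y_indep.
  have := @card_nonU _ _ _ U y _ (Y_disj i j ij); rewrite subUset !sY => /(_ isT).
  have := U_non y yU; have := Y_ge i; lia.
(* The size that [greedy_blowup] asks of each part for eta = 6 d. *)
pose th := r * (t * (6 * d)) + t.
have th_le : th <= 7 * (r * t * d).
  have : t <= r * t * d by rewrite mulnAC leq_pmull // muln_gt0 r_gt0.
  by rewrite /th; lia.
have D_ge : 18 * d + 3 * th <= D.
  have : r * (18 * d + 3 * th) <= r * D.
    have : \sum_i #|Y i| <= r * D.
      by rewrite -[r in _ <= r * _]card_ord -sum_nat_const; apply: leq_sum.
    have : r * (18 * d + 3 * th) <= r * (39 * (r * t * d)).
      by rewrite leq_mul2l; lia.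
    have : d <= w by rewrite -w_r (leq_trans d_w) // leq_pmull.
    lia.
  by rewrite leq_pmul2l.
have few' v : v \in U -> exists i, #|nb (Y i) v| < th.
  move=> vU; case: (boolP [exists i, #|nb (Y i) v| < th]) => [/existsP//|].
  rewrite negb_exists => /forallP nb_big; case: noplus; apply: (blowup_nb_plus _ _ vU) => //.
  have [||X' bX' X'_Y] := @greedy_blowup _ t (6 * d) _ (fun i => nb (Y i) v).
  - by move=> i; rewrite leqNgt; apply: nb_big.
  - move=> i j ij y; rewrite inE => /andP[yY _].
    by apply: leq_trans (Y_non i j y ij yY); apply/subset_leq_card/nonS/nb_sub.
  exists X' => // i; have [sX' ->] := X'_Y i; split=> //.
  exact: subset_trans sX' (nbS _ (sY i)).
(* The value 0 arises only outside U. *)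
pose p v := if [pick i | #|nb (Y i) v| < th] is Some i then i : nat else 0.
have pP v : v \in U -> exists2 i : 'I_r, p v = i & #|nb (Y i) v| < th.
  move=> vU; rewrite /p; case: pickP => [i lt|none]; first by exists i.
  by have [i] := few' v vU; rewrite none.
exists p; split=> [v /pP[i -> _]//|u v uU vU uv].
have [i -> u_i] := pP u uU; have [j -> v_j] := pP v vU.
apply/negP => /eqP/val_inj ij; rewrite -{j}ij in v_j.
have far x j : x \in U -> #|nb (Y i) x| < th -> j != i -> #|non (Y j) x| <= 6 * d + th.
  move=> xU x_i ji; have ij : i != j by rewrite eq_sym.
  have := @card_nonU _ _ _ U x _ (Y_disj i j ij); rewrite subUset !sY => /(_ isT).
  have := U_non x xU; have := Y_ge i; have := card_nb_non (Y i) x; lia.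
apply: noplus.
(* Adjacent u and v of the same colour i miss nearly all of Y i and therefore little of the other
   sets; their common neighbours there, together with Y i, give [has_plus] around u v. *)
pose Y' j := if j == i then Y i else nb (nb (Y j) u) v.
have sY' j : Y' j \subset Y j.
  rewrite /Y'; case: eqP => [->|_] //; exact: subset_trans (nb_sub _ _) (nb_sub _ _).
have [||X' bX' X'_Y] := @greedy_blowup _ t (6 * d) _ Y'.
- move=> j; rewrite -/th /Y'; case: eqP => [_|/eqP ji].
    by have := Y_ge i; lia.
  have := card_nb_non (Y j) u; have := card_nb_non (nb (Y j) u) v.
  have := subset_leq_card (nonS v (nb_sub (Y j) u)).
  have := far u j uU u_i ji; have := far v j vU v_j ji; have := Y_ge j; lia.
- move=> j k jk y yY; apply: leq_trans (Y_non j k y jk _).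
    exact/subset_leq_card/nonS/sY'.
  exact: subsetP (sY' j) _ yY.
exists X', i, u, v; split=> //.
  move=> j; have [sX' ->] := X'_Y j; split=> //.
  exact: subset_trans sX' (subset_trans (sY' j) (sY j)).
move=> j /negPf ji x xX; have := subsetP (X'_Y j).1 x xX.
by rewrite /Y' ji !inE => /andP[/andP[_ ->]].
Qed.

(** * Sums of squares *)

(* The least sum of the squares of s integers with sum m. *)
Definition balanced_sqr s m := \sum_(i < s) (m %/ s + (i < m %% s)) ^ 2.

(* The line is the chord of x^2 through q and q + 1, between which no integer lies. *)
Lemma sqr_chord q x :
  (2 * q + 1) * x <= x ^ 2 + q * q.+1 ?= iff ((x == q) || (x == q.+1)).
Proof.
rewrite -mulnn; case: (leqP x q) => [xq|qx].
  have [d ->] : exists d, q = x + d by exists (q - x); lia.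
  rewrite (_ : x * x + _ = (2 * (x + d) + 1) * x + d * d.+1); last by lia.
  split; first exact: leq_addr.
  by rewrite -[X in X == _]addn0 eqn_add2l; case: d => [|d]; apply/eqP/orP; lia.
have [d ->] : exists d, x = q.+1 + d by exists (x - q.+1); lia.
rewrite (_ : _ * _ + q * _ = (2 * q + 1) * (q.+1 + d) + d * d.+1); last by lia.
split; first exact: leq_addr.
by rewrite -[X in X == _]addn0 eqn_add2l; case: d => [|d]; apply/eqP/orP; lia.
Qed.

Lemma sum_sqr_chord (I : finType) (A : {set I}) (f : I -> nat) q :
  (2 * q + 1) * \sum_(i in A) f i <= \sum_(i in A) f i ^ 2 + #|A| * (q * q.+1)
    ?= iff [forall (i | i \in A), (f i == q) || (f i == q.+1)].
Proof.
rewrite big_distrr -sum_nat_const -big_split /=.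
by apply: leqif_sum => i _; apply: sqr_chord.
Qed.

Lemma sum_ltn_ord s k : k <= s -> \sum_(i < s) (i < k) = k.
Proof.
move=> ks; rewrite -[RHS]subn0 -[RHS]muln1 -sum_nat_const_nat big_mkord.
rewrite (big_ord_widen _ (fun=> 1) ks) big_mkcond [RHS]big_mkcond.
by apply: eq_bigr => i _; case: (i < k).
Qed.

Lemma balanced_sqr_parts s m : 0 < s -> exists f : 'I_s -> nat,
  [/\ \sum_i f i = m, \sum_i f i ^ 2 = balanced_sqr s m &
      forall i, f i = m %/ s \/ f i = (m %/ s).+1].
Proof.
move=> s0; exists (fun i => m %/ s + (i < m %% s)); split=> // [|i].
  rewrite big_split /= sum_nat_const card_ord sum_ltn_ord; last exact/ltnW/ltn_pmod.
  by rewrite mulnC -divn_eq.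
by case: (i < _); rewrite ?addn1 ?addn0; [right|left].
Qed.

(** This sums the chord bound over a balanced sequence; q is arbitrary, and the next lemma gives
    equality for q = m %/ s. *)
Lemma balanced_sqr_ge s m q : 0 < s ->
  (2 * q + 1) * m <= balanced_sqr s m + s * (q * q.+1).
Proof.
move=> s0; have [f [fm <- _]] := balanced_sqr_parts m s0.
have [le _] := sum_sqr_chord [set: 'I_s] f q; move: le.
by rewrite cardsT card_ord !sum_setT fm.
Qed.

Lemma balanced_sqr_divn s m : 0 < s ->
  balanced_sqr s m + s * (m %/ s * (m %/ s).+1) = (2 * (m %/ s) + 1) * m.
Proof.
move=> s0; have [f [fm <- fq]] := balanced_sqr_parts m s0.
have [_] := sum_sqr_chord [set: 'I_s] f (m %/ s).
rewrite cardsT card_ord !sum_setT fm => eq_iff; apply/esym/eqP.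
rewrite eq_iff; apply/forall_inP => i _.
by case: (fq i) => ->; rewrite eqxx ?orbT.
Qed.

(** At the upper end the quotient is already q.+1, but the chords at q and q.+1 agree there. The
    closed interval lets two groups share one q. *)
Lemma balanced_sqrE s m q : 0 < s -> s * q <= m <= s * q.+1 ->
  balanced_sqr s m + s * (q * q.+1) = (2 * q + 1) * m.
Proof.
move=> s0 /andP[ge le]; have := balanced_sqr_divn m s0.
have [->|lt] := eqVneq m (s * q.+1).
  rewrite mulKn //; nia.
have -> // : m %/ s = q.
by apply/eqP; rewrite eqn_leq leq_divRL // -ltnS ltn_divLR //; lia.
Qed.

Lemma balanced_sqr_min (I : finType) (A : {set I}) (f : I -> nat) s m :
  0 < s -> #|A| = s -> \sum_(i in A) f i = m ->
  balanced_sqr s m <= \sum_(i in A) f i ^ 2.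
Proof.
move=> s0 As fm; have := balanced_sqr_divn m s0.
have [] := sum_sqr_chord A f (m %/ s); rewrite As fm; lia.
Qed.

Lemma balanced_sqr_attained (I : finType) (A : {set I}) (f : I -> nat) s m c :
  0 < s -> #|A| = s -> \sum_(i in A) f i = m ->
  (forall i, i \in A -> f i = c \/ f i = c.+1) ->
  \sum_(i in A) f i ^ 2 = balanced_sqr s m.
Proof.
move=> s0 As fm fc; apply/eqP; rewrite eqn_leq (balanced_sqr_min s0 As fm) andbT.
have [_] := sum_sqr_chord A f c; rewrite As fm.
have -> : [forall (i | i \in A), (f i == c) || (f i == c.+1)].
  by apply/forall_inP => i /fc[] ->; rewrite eqxx ?orbT.
by have := balanced_sqr_ge m c s0; move=> le /eqP; lia.
Qed.

(** The chord at q = m.+1 %/ s is exact at m.+1, a lower bound at m, and has slope 2 q + 1. This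
    controls the bound when a vertex is deleted. *)
Lemma balanced_sqr_succ s m : 0 < s ->
  balanced_sqr s m.+1 <= balanced_sqr s m + 2 * (m.+1 %/ s) + 1.
Proof.
move=> s0; have := balanced_sqr_divn m.+1 s0.
have := balanced_sqr_ge m (m.+1 %/ s) s0; lia.
Qed.

Lemma balanced_sqr_le s m : 0 < s -> balanced_sqr s m <= m ^ 2.
Proof.
case: s => // s _; pose f (i : 'I_s.+1) := if i == ord0 then m else 0.
have -> : m ^ 2 = \sum_(i in [set: 'I_s.+1]) f i ^ 2.
  rewrite (bigD1 ord0) ?inE //= big1 ?addn0 // => i /andP[_ /negPf i0].
  by rewrite /f i0.
apply: balanced_sqr_min => //; first by rewrite cardsT card_ord.
rewrite (bigD1 ord0) ?inE //= big1 ?addn0 // => i /andP[_ /negPf i0].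
by rewrite /f i0.
Qed.

(** Take m - s * q indices of value q.+1 and fill up to s with indices of value q; the bounds on m
    and n - m ensure that there are enough of both. *)
Lemma near_constant_group r s k n m q (x : 'I_r -> nat) :
  r = s + k -> \sum_i x i = n -> (forall i, x i = q \/ x i = q.+1) -> m <= n ->
  s * q <= m <= s * q.+1 -> k * q <= n - m <= k * q.+1 ->
  exists A : {set 'I_r}, #|A| = s /\ \sum_(i in A) x i = m.
Proof.
move=> rsk xn xq mn /andP[m_ge m_le] /andP[b_ge b_le].
pose B := [set i | x i == q.+1].
have xE i : x i = q + (i \in B).
  by rewrite inE; case: (xq i) => ->; rewrite ?eqxx ?addn1 // ltn_eqF ?addn0.
have sumx (A : {set 'I_r}) : \sum_(i in A) x i = #|A| * q + #|A :&: B|.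
  rewrite (eq_bigr _ (fun i _ => xE i)) big_split /= sum_nat_const; congr (_ + _).
  rewrite -sum1_card big_mkcond [RHS]big_mkcond; apply: eq_bigr => i _.
  by rewrite in_setI; case: (i \in A); case: (i \in B).
have cB : r * q + #|B| = n.
  by rewrite -xn -sum_setT sumx setTI cardsT card_ord.
have cCB : #|B| + #|~: B| = r by rewrite cardsC card_ord.
have [|A1 sA1 cA1] := @subset_of_card _ B (m - s * q); first nia.
have [|A2 sA2 cA2] := @subset_of_card _ (~: B) (s - (m - s * q)); first nia.
exists (A1 :|: A2).
have dA : A2 :&: B = set0.
  by apply/eqP; rewrite setI_eq0 disjoints_subset.
have dA12 : A1 :&: A2 = set0.
  by apply/eqP; rewrite -subset0 -dA setIC setIS.
have cA : #|A1 :|: A2| = s by rewrite cardsU dA12 cards0 cA1 cA2; nia.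
by split=> //; rewrite sumx cA setIUl dA setU0 (setIidPl sA1) cA1; lia.
Qed.

(** A stands for s classes covering M, which may hold d further vertices. As s n <= r m, the
    quotients satisfy p <= q, so moving d vertices from the flatter chord to the steeper one cannot
    lower the sum. If equality holds with d > 0, then p = q, all values are q or q.+1, and s of them
    can be regrouped to sum to m. *)
Lemma grouped_sum_sqr r s k n m (x : 'I_r -> nat) (A : {set 'I_r}) :
    0 < s -> 0 < k -> r = s + k -> #|A| = s -> m <= \sum_(i in A) x i ->
    \sum_i x i = n -> s * n <= r * m ->
  balanced_sqr s m + balanced_sqr k (n - m) <= \sum_i x i ^ 2 /\
  (\sum_i x i ^ 2 = balanced_sqr s m + balanced_sqr k (n - m) ->
   exists (A' : {set 'I_r}) q p, [/\ #|A'| = s, \sum_(i in A') x i = m,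
     forall i, i \in A' -> x i = q \/ x i = q.+1 &
     forall i, i \in ~: A' -> x i = p \/ x i = p.+1]).
Proof.
move=> s0 k0 rsk As mA xn sn.
have split_sum (F : 'I_r -> nat) :
    \sum_i F i = \sum_(i in A) F i + \sum_(i in ~: A) F i.
  by rewrite (bigID (mem A)) /=; congr (_ + _); apply: eq_bigl => i; rewrite inE.
have cA : #|~: A| = k by have := cardsC A; rewrite card_ord; lia.
pose q := m %/ s; pose p := (n - m) %/ k.
have mn : m <= n by rewrite -xn split_sum; lia.
have pq : p <= q.
  rewrite leq_divRL // -(leq_pmul2l k0); have := leq_trunc_div (n - m) k.
  by rewrite -/p => pk; have : s * (p * k) <= s * (n - m); [rewrite leq_mul2l pk orbT|lia].
have Qm := balanced_sqr_divn m s0; have Qb := balanced_sqr_divn (n - m) k0.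
rewrite -/q -/p in Qm Qb.
have [leA eqA] := sum_sqr_chord A x q; have [leB eqB] := sum_sqr_chord (~: A) x p.
rewrite As in leA eqA; rewrite cA in leB eqB.
rewrite split_sum in xn; rewrite split_sum.
have [d dE] : exists d, \sum_(i in A) x i = m + d.
  by exists (\sum_(i in A) x i - m); rewrite subnKC.
have bE : n - m = d + \sum_(i in ~: A) x i by rewrite -xn dE; lia.
have gap : (2 * p + 1) * d <= (2 * q + 1) * d by rewrite leq_mul2r; lia.
rewrite dE in leA eqA; rewrite bE in Qb *.
split; first by lia.
move=> tight.
have tightA : (2 * q + 1) * (m + d) =
    \sum_(i in A) x i ^ 2 + s * (q * q.+1) by lia.
have tightB : (2 * p + 1) * \sum_(i in ~: A) x i =
    \sum_(i in ~: A) x i ^ 2 + k * (p * p.+1) by lia.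
have xA i : i \in A -> x i = q \/ x i = q.+1.
  by move: eqA; rewrite tightA eqxx => /esym/forall_inP all_i /all_i /orP[]/eqP; tauto.
have xB i : i \in ~: A -> x i = p \/ x i = p.+1.
  by move: eqB; rewrite tightB eqxx => /esym/forall_inP all_i /all_i /orP[]/eqP; tauto.
have [d0|d_gt0] := posnP d.
  by exists A, q, p; split=> //; rewrite dE d0 addn0.
have qp : q = p.
  have : (2 * p + 1) * d = (2 * q + 1) * d by lia.
  by move/eqP; rewrite eqn_pmul2r //; lia.
have x_q i : x i = q \/ x i = q.+1.
  have [/xA//|] := boolP (i \in A); rewrite -in_setC qp; exact: xB.
have m_q : s * q <= m <= s * q.+1.
  by rewrite mulnC leq_trunc_div mulnC ltnW // ltn_ceil.
have b_q : k * q <= n - m <= k * q.+1.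
  by rewrite qp mulnC leq_trunc_div mulnC ltnW // ltn_ceil.
have [|A' [cA' xA']] := near_constant_group rsk _ x_q mn m_q b_q.
  by rewrite split_sum.
by exists A', q, q.
Qed.

(* When m is within one vertex of s n / r, the two balanced groups together
   form a balanced r-partition. *)
Lemma balanced_groups_boundary s k n m : 0 < s -> 0 < k -> m <= n ->
    s * n <= (s + k) * m -> (s + k) * m < s * n + k ->
  exists2 q, s * q <= m <= s * q.+1 & k * q <= n - m <= k * q.+1.
Proof.
move=> s0 k0 mn; move: (n - m) (subnKC mn) => b nE; subst n => ge lt.
have {}ge : s * b <= k * m by lia.
have {}lt : k * m < s * b + k by lia.
have := divn_eq m s; have := ltn_pmod m s0.
set q := m %/ s; set e := m %% s => es mE; rewrite mE mulnDr in ge lt.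
have b_le : k * q <= b + k * (e == 0).
  rewrite -(@leq_pmul2l s) //; case: e {es mE} ge lt => [|e] ge lt.
    have : k <= s * k by rewrite leq_pmull.
    lia.
  have : k <= k * e.+1 by rewrite leq_pmulr.
  lia.
have b_le' : b <= k * q.+1 - k * (e == 0).
  rewrite -(@leq_pmul2l s) //; case: e es {mE b_le} ge lt => [|e] es ge lt; first by lia.
  have : k * e.+1 <= k * s by rewrite leq_mul2l ltnW ?orbT.
  lia.
have [e0|e_gt0] := posnP e; last first.
  by exists q; rewrite (negPf (lt0n_neq0 e_gt0)) in b_le b_le'; lia.
rewrite e0 eqxx in b_le b_le' mE; case: q {ge lt} mE b_le b_le' => [|q] mE b_le b_le'.
  by exists 0; lia.
by exists q; lia.
Qed.

(** The chord at q is exact for m, n - m and n at once. *)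
Lemma balanced_sqrD s k n m q : 0 < s -> 0 < k -> m <= n ->
  s * q <= m <= s * q.+1 -> k * q <= n - m <= k * q.+1 ->
  balanced_sqr s m + balanced_sqr k (n - m) = balanced_sqr (s + k) n.
Proof.
move=> s0 k0 mn m_q b_q.
have := balanced_sqrE s0 m_q; have := balanced_sqrE k0 b_q.
have := @balanced_sqrE (s + k) n q; rewrite addn_gt0 s0 => /(_ isT).
move: b_q (subnKC mn); set b := n - m => b_q <- n_q.
have /n_q : (s + k) * q <= m + b <= (s + k) * q.+1 by lia.
lia.
Qed.

(** * Simonovits' and Turan's theorems *)

(* Configurations of size just above n1 exceed the bound by at most n1 ^ 2;
   every deletion of a vertex decreases the excess, so that it disappears
   before the size n1 + n1 ^ 2 + 1 is reached. *)
Lemma deletion_induction (C : Type) (inv : C -> Prop) (size weight : C -> nat)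
    (tight : C -> Prop) n1 :
    (forall c, inv c -> weight c <= 2 * size c ^ 2) ->
    (forall c, inv c -> n1 <= size c ->
       (weight c <= size c ^ 2 /\ (weight c = size c ^ 2 -> tight c)) \/
       exists c', [/\ inv c', size c = (size c').+1 &
                      weight c + size c' ^ 2 < weight c' + size c ^ 2]) ->
  forall c, inv c -> n1 + n1 ^ 2 < size c ->
    weight c <= size c ^ 2 /\ (weight c = size c ^ 2 -> tight c).
Proof.
move=> weight_le step.
have claim d c : inv c -> size c = n1 + d ->
    (weight c <= size c ^ 2 /\ (weight c = size c ^ 2 -> tight c)) \/
    weight c + d <= size c ^ 2 + n1 ^ 2.
  elim: d c => [|d IHd] c ic cE.
    by right; have := weight_le c ic; rewrite cE !addn0; lia.
  have [|good|[c' [ic' sc' lt]]] := step c ic; [by lia|by left|].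
  have [|[le _]|le] := IHd c' ic'; first by lia.
    by left; split; lia.
  by right; lia.
move=> c ic lt; have [|//|le] := claim (size c - n1) c ic; first lia.
by split; lia.
Qed.

(** Deleting a vertex with at least |U| / r + 2 non-neighbours raises the excess, strictly because
    of the 2. Without such a vertex [plus_free_colorable] applies, and [balanced_sqr_min] bounds the
    squares of the class sizes. *)
Lemma simonovits r t : 0 < r -> 0 < t -> exists n0,
  forall (G : sgraph) (U : {set G}), n0 <= #|U| -> ~ has_plus r t U ->
  degsum U + balanced_sqr r #|U| <= #|U| ^ 2 /\
  (degsum U + balanced_sqr r #|U| = #|U| ^ 2 ->
   exists2 p, forall x, x \in U -> p x < r & complete_on U p).
Proof.
move=> r0 t0; have [L [n0 col]] := plus_free_colorable r0 t0.
pose n1 := n0 + L * r + 1; exists (n1 + n1 ^ 2).+1 => G U Ubig noplus.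
pose wt (V : {set G}) := degsum V + balanced_sqr r #|V|.
apply: (@deletion_induction {set G} (fun V => ~ has_plus r t V) (fun V => #|V|) wt
          (fun V => exists2 p, forall x, x \in V -> p x < r & complete_on V p) n1) => //.
  by move=> V _; have := degsum_le V; have := balanced_sqr_le #|V| r0; rewrite /wt; lia.
move=> {U Ubig noplus} U noplus Ubig; rewrite /wt.
have [[v vU v_low]|high] : (exists2 v, v \in U & #|U| %/ r + 2 <= #|non U v|) \/
    forall v, v \in U -> #|non U v| <= #|U| %/ r + 1.
- have [/exists_inP|] := boolP [exists (v | v \in U), #|U| %/ r + 2 <= #|non U v|].
    by left.
  rewrite negb_exists_in => /forall_inP high; right=> v /high; lia.
- right; exists (U :\ v); have := cardsD1 v U; rewrite vU add1n => UE.
  split=> //; first by move=> /(has_plus_sub (subsetDl _ _)).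
  have := balanced_sqr_succ #|U :\ v| r0; rewrite -UE (degsumD1 vU).
  have := card_nb_non U v; move: v_low; rewrite UE -!mulnn; lia.
left; have [||//|p p_pr] := col G U _ _ high; first by lia.
  have := leq_trunc_div #|U| r; have : L * r <= #|U| by lia.
  move: (#|U| %/ r) => q lr qr.
  have : L * (q * r) <= L * #|U| by rewrite leq_mul2l qr orbT.
  lia.
have [le eqc] := proper_degsum p_pr; have [p_lt _] := p_pr.
have Qle : balanced_sqr r #|U| <= \sum_(i < r) #|cls U p i| ^ 2.
  rewrite -sum_setT; apply: balanced_sqr_min => //; first by rewrite cardsT card_ord.
  by rewrite sum_setT card_cls.
by split=> [|eqU]; [lia|exists p => //; apply: eqc; lia].
Qed.

(* A clique on j vertices, picked one at a time, whose common neighbourhood in U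
   satisfies P. *)
Fixpoint linked (G : sgraph) (P : {set G} -> Prop) j (U : {set G}) : Prop :=
  if j is j'.+1 then exists2 c, c \in U & linked P j' (nb U c) else P U.

Section Linked.
Variable G : sgraph.
Implicit Types (U V M B C : {set G}) (P : {set G} -> Prop).

Lemma linkedSr P j U :
  linked P j.+1 U -> linked (fun V => exists2 c, c \in V & P (nb V c)) j U.
Proof.
by elim: j U => [|j IHj] U [c cU link] //; exists c => //; apply: IHj.
Qed.

Lemma linked_imp P P' j U : (forall V, V \subset U -> P V -> P' V) ->
  linked P j U -> linked P' j U.
Proof.
elim: j U => [|j IHj] U PP' /=; first exact: PP'.
move=> [c cU link]; exists c => //; apply: IHj link => V sV; apply: PP'.
exact: subset_trans sV (nb_sub _ _).
Qed.

(** A vertex c of a part other than i0 is joined to u, v and all other parts, so these survive in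
    its neighbourhood with one part fewer. *)
Lemma has_plus_apex q t U : 0 < q -> 0 < t -> has_plus q.+1 t U ->
  exists2 c, c \in U & has_plus q t (nb U c).
Proof.
move=> q0 t0 [X [i0 [u [v [bX X_U [uU vU uv] uvX]]]]].
have [j ji] : exists j, j != i0.
  have [->|ne] := eqVneq i0 ord0; last by exists ord0; rewrite eq_sym.
  by exists ord_max; rewrite -val_eqE /= -lt0n.
have [sXj tXj] := X_U j; have /card_gt0P[c cX] : 0 < #|X j| by apply: leq_trans tXj.
have [i1 i0E] : exists i1, i0 = lift j i1.
  by case: (unliftP j i0) ji => [i1 ->|->]; [exists i1|rewrite eqxx].
exists c; first exact: subsetP sXj c cX.
have [uc vc] := uvX j ji c cX.
exists (fun i => X (lift j i)), i1, u, v; split=> //.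
- by move=> i i' ii'; apply: bX; rewrite (inj_eq lift_inj).
- move=> i; have [sXi tXi] := X_U (lift j i); split=> //; apply/subsetP => x xX.
  by rewrite inE (subsetP sXi) // (bX j (lift j i)) // neq_lift.
- by rewrite !inE uU vU ![adj c _]adj_sym uc vc.
- by move=> i ii; apply: uvX; rewrite i0E (inj_eq lift_inj).
Qed.

Lemma has_plus_linked s k t U : 0 < s -> 0 < t -> has_plus (s + k) t U ->
  linked (has_plus s t) k U.
Proof.
move=> s0 t0; elim: k U => [|k IHk] U; first by rewrite addn0.
rewrite addnS => plus; have [|c cU link] := has_plus_apex _ t0 plus.
  by rewrite addn_gt0 s0.
by exists c => //; apply: IHk.
Qed.

(** The clique lies in B, but non-neighbours are counted in all of U, so each clique vertex costs
    the common neighbourhood in U at most d vertices. *)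
Lemma linked_lift P d j B U : B \subset U ->
    (forall x, x \in B -> #|non U x| <= d) ->
    (forall C, C \subset U -> #|U| <= #|C| + j * d -> P C) ->
  linked (fun=> True) j B -> linked P j U.
Proof.
elim: j B U => [|j IHj] B U sBU B_non PC /=.
  by move=> _; apply: PC; rewrite ?leq_addr.
move=> [c cB link]; exists c; first exact: subsetP sBU c cB.
apply: IHj link; first exact: nbS.
  move=> x; rewrite inE => /andP[xB _]; apply: leq_trans (B_non x xB).
  exact: subset_leq_card (nonS _ (nb_sub _ _)).
move=> C sC le; apply: PC; first exact: subset_trans sC (nb_sub _ _).
by have := card_nb_non U c; have := B_non c cB; lia.
Qed.

(* Erdos' proof of Turan's theorem: the non-neighbours of a vertex of maximum
   degree form one part. *)
Lemma turan_majorization k U : ~ linked (fun=> True) k.+1 U -> exists p,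
  [/\ forall x, x \in U -> p x < k,
      degsum U + \sum_(i < k) #|cls U p i| ^ 2 <= #|U| ^ 2 &
      degsum U + \sum_(i < k) #|cls U p i| ^ 2 = #|U| ^ 2 -> complete_on U p].
Proof.
elim: k U => [|k IHk] U nolink; have [U0|[x0 x0U]] := set_0Vmem U.
- by exists (fun=> 0); split=> [x||_ x y]; rewrite U0 ?inE // /degsum big_set0 big_ord0.
- by case: nolink; exists x0.
- exists (fun=> 0); split=> [x||_ x y]; rewrite U0 ?inE // /degsum big_set0 big1 // => i _.
  by rewrite (_ : cls _ _ _ = set0) ?cards0 //; apply/setP => x; rewrite !inE.
have [x xU x_max] : exists2 x, x \in U & forall y, y \in U -> #|nb U y| <= #|nb U x|.
  by case: (arg_maxnP (fun y => #|nb U y|) x0U) => x xU x_max; exists x.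
pose N := nb U x; pose Z := U :\: N.
have sNU : N \subset U := nb_sub U x.
have dZN : [disjoint Z & N] by rewrite disjoints_subset /Z setDE subsetIr.
have UE : U = Z :|: N by rewrite setUC -{1}(setID U N) (setIidPr sNU).
have [|p [p_lt p_le p_eq]] := IHk N; first by move=> link; case: nolink; exists x.
pose p' y := if y \in N then p y else k.
have cls_lt (i : 'I_k) : cls U p' i = cls N p i.
  apply/setP => y; rewrite !inE /p'; case yN: (y \in N); move: (yN); rewrite inE.
    by case/andP=> -> ->.
  by move=> ->; rewrite gtn_eqF ?andbF.
have cls_k : cls U p' k = Z.
  apply/setP => y; rewrite in_setD !inE /p'; case yN: (y \in N).
    by rewrite ltn_eqF ?andbF ?p_lt //; move: yN; rewrite inE => ->.
  by move: yN; rewrite inE => ->; rewrite eqxx andbT.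
have cU : #|U| = #|Z| + #|N|.
  by rewrite {1}UE cardsU (_ : Z :&: N = set0) ?cards0 ?subn0 //; apply/eqP; rewrite setI_eq0.
have sumE : \sum_(i < k.+1) #|cls U p' i| ^ 2 = \sum_(i < k) #|cls N p i| ^ 2 + #|Z| ^ 2.
  rewrite big_ord_recr /= cls_k; congr (_ + _); apply: eq_bigr => i _.
  by rewrite -cls_lt.
have nbZN z : z \in Z -> #|nb Z z| + #|nb N z| <= #|N|.
  move=> zZ; have zU : z \in U by rewrite UE inE zZ.
  by have := x_max z zU; rewrite -/N {1}UE nbU.
have cross : degsum Z + \sum_(z in Z) #|nb N z| <= #|Z| * #|N|.
  by rewrite /degsum -big_split -sum_nat_const; apply: leq_sum.
have degE : degsum U = degsum Z + degsum N + 2 * \sum_(z in Z) #|nb N z|.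
  by rewrite {1}UE degsumU.
(* Doubling [cross] leaves a spare [degsum Z] on the left, so that equality in the bound forces Z to
   be independent. *)
have le : degsum U + degsum Z + \sum_(i < k.+1) #|cls U p' i| ^ 2 <= #|U| ^ 2.
  by rewrite degE sumE cU sqrnD; lia.
exists p'; split=> [y yU||tight]; last 1 first.
- have Z0 : degsum Z = 0 by lia.
  have tightN : degsum N + \sum_(i < k) #|cls N p i| ^ 2 = #|N| ^ 2.
    by move: tight; rewrite degE sumE cU sqrnD; lia.
  have tightZ : #|Z| * #|N| = \sum_(z in Z) #|nb N z|.
    by move: tight; rewrite degE sumE cU sqrnD; lia.
  have nbZ z y : z \in Z -> y \in Z -> adj z y = false.
    move=> zZ yZ; move/eqP: Z0; rewrite sum_nat_eq0 => /forall_inP/(_ z zZ).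
    by rewrite cards_eq0 => /eqP/setP/(_ y); rewrite in_set0 inE yZ.
  have nbN z y : z \in Z -> y \in N -> adj z y.
    move=> zZ yN; have : #|nb N z| == #|N|.
      have le1 y' : y' \in Z -> #|nb N y'| <= #|N| ?= iff (#|nb N y'| == #|N|).
        by move=> _; split=> //; apply/subset_leq_card/nb_sub.
      have [_] := leqif_sum le1; rewrite sum_nat_const tightZ eqxx.
      by move=> /esym/forall_inP/(_ z zZ).
    rewrite (subset_leqif_card (nb_sub N z)) => /subsetP/(_ y yN).
    by rewrite inE => /andP[].
  have lt y : y \in N -> p' y < k by move=> yN; rewrite /p' yN p_lt.
  have eqk y : y \in Z -> p' y = k.
    by rewrite in_setD /p' => /andP[/negPf ->].
  move=> y z; rewrite {1 2}UE 2!in_setU => /orP[yZ|yN] /orP[zZ|zN].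
  + by rewrite nbZ // !eqk // eqxx.
  + by rewrite nbN // eqk // gtn_eqF ?lt.
  + by rewrite adj_sym nbN // (eqk z) // ltn_eqF ?lt.
  + by rewrite /p' yN zN p_eq.
- by rewrite /p'; case yN: (y \in N) => //; rewrite ltnS ltnW ?p_lt.
- by lia.
Qed.

End Linked.

(** * The bound for a set M *)

Section Groups.
Variable G : sgraph.
Implicit Types (U M : {set G}) (p : G -> nat).

Lemma card_le_group U M r p (A : {set 'I_r}) : M \subset U ->
    (forall x, x \in M -> exists2 i : 'I_r, i \in A & p x = i) ->
  #|M| <= \sum_(i in A) #|cls U p i|.
Proof.
move=> sMU MA; apply: leq_trans (card_bigcup_le _ _).
apply/subset_leq_card/subsetP => x xM; have [i iA pxi] := MA x xM.
by apply/bigcupP; exists i => //; rewrite inE (subsetP sMU) // pxi /=.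
Qed.

(** The classes are almost equal in size and almost completely joined. At least s of them contain th
    vertices of M, since fewer could not hold s |U| / r vertices; a vertex of M outside s such
    classes would see most of M in each of them and create [has_plus] in M. *)
Lemma plus_free_group s r t D eta U M p :
    M \subset U -> proper_on U r p -> (forall x, x \in U -> #|non U x| <= D) ->
    0 < s -> 0 < t -> s <= r -> r * D <= #|U| + eta -> s * #|U| <= r * #|M| ->
    ~ has_plus s t M -> r * (r * (s * (t * eta) + t + eta)) + s * eta < #|U| ->
  exists2 A : {set 'I_r}, #|A| = s &
    forall x, x \in M -> exists2 i : 'I_r, i \in A & p x = i.
Proof.
move=> sMU [p_lt p_pr] U_non s0 t0 sr rD sn noplus big.
(* [greedy_blowup] needs s * (t * eta) + t vertices in each part, and eta more may be lost on
   passing to the neighbours of x. *)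
set th := s * (t * eta) + t + eta in big.
pose M_ (i : 'I_r) := [set x in M | p x == i].
pose A0 := [set i | th <= #|M_ i|].
have cls_le (i : nat) : #|cls U p i| <= D.
  have [->|[x xi]] := set_0Vmem (cls U p i); first by rewrite cards0.
  have := xi; rewrite inE => /andP[xU /eqP pxi].
  apply: leq_trans (U_non x xU); apply/subset_leq_card/indep_sub_non.
    by apply/subsetP => y; rewrite inE => /andP[].
  move=> y; rewrite inE => /andP[yU /eqP pyi]; apply/negP => /(p_pr x y xU yU).
  by rewrite pxi pyi eqxx.
have cls_sum := card_cls p_lt.
have rD_ge : #|U| <= r * D.
  by rewrite -cls_sum -[r in r * D]card_ord -sum_nat_const; apply: leq_sum.
have cls_ge (i : 'I_r) : D <= #|cls U p i| + eta.
  have : \sum_(i < r) #|cls U p i| <= #|cls U p i| + r.-1 * D.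
    rewrite (bigD1 i) //= leq_add2l.
    have -> : r.-1 = #|[pred j | j != i]|.
      by have := cardC1 i; rewrite card_ord => <-; apply: eq_card.
    by rewrite -sum_nat_const; apply: leq_sum.
  have : r * D = D + r.-1 * D by rewrite -mulSn prednK // (leq_trans s0).
  by rewrite cls_sum; lia.
have miss (i j : 'I_r) x : j != i -> x \in cls U p i -> #|non (cls U p j) x| <= eta.
  move=> ji; rewrite inE => /andP[xU /eqP pxi].
  have d_ij : [disjoint cls U p i & cls U p j].
    apply/pred0P => y /=; rewrite !inE; apply/negP => /andP[/andP[_ /eqP->]].
    by rewrite val_eqE eq_sym (negPf ji) andbF.
  have scls k : cls U p k \subset U by apply/subsetP => y; rewrite inE => /andP[].
  have : #|non (cls U p i) x| = #|cls U p i|.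
    apply/eqP; rewrite eqn_leq; apply/andP; split; apply: subset_leq_card.
      by apply/subsetP => z; rewrite inE => /andP[].
    apply: indep_sub_non => // y; rewrite inE => /andP[yU /eqP pyi].
    by apply/negP => /(p_pr x y xU yU); rewrite pxi pyi eqxx.
  have := @card_nonU _ _ _ U x _ d_ij; rewrite subUset !scls => /(_ isT).
  by have := U_non x xU; have := cls_ge i; lia.
have sA0 : s <= #|A0|.
  rewrite leqNgt; apply/negP => lt_s.
  have M_le : #|M| <= s.-1 * D + r * th.
    have -> : #|M| = \sum_(i < r) #|M_ i|.
      by rewrite -(@card_cls _ M r p) // => x xM; rewrite p_lt ?(subsetP sMU).
    apply: (@leq_trans (\sum_(i in A0) D + \sum_(i < r) th)); last first.
      by rewrite !sum_nat_const card_ord leq_add2r leq_mul2r; lia.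
    rewrite (bigID (mem A0)) /=; apply: leq_add.
      apply: leq_sum => i _; apply: leq_trans (cls_le i); apply/subset_leq_card/subsetP => x.
      by rewrite !inE => /andP[xM ->]; rewrite (subsetP sMU).
    rewrite big_mkcond; apply: leq_sum => i _; case: ifP => //.
    by rewrite inE -ltnNge => /ltnW.
  have : r * #|M| <= r * (s.-1 * D + r * th) by rewrite leq_mul2l M_le orbT.
  have : s * (r * D) <= s * (#|U| + eta) by rewrite leq_mul2l rD orbT.
  have : s * (r * D) = r * D + r * (s.-1 * D) by case: (s) s0 => // s' _; lia.
  by lia.
have [A sAA0 cA] := subset_of_card sA0.
exists A => // x xM; have xU := subsetP sMU x xM.
have [i pxi] : exists i : 'I_r, p x = i by exists (Ordinal (p_lt x xU)).
exists i => //; apply/negPn/negP => iA; apply: noplus.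
have xi : x \in cls U p i by rewrite inE xU pxi /=.
apply: (blowup_nb_plus s0 t0 xM).
have sM_cls j : M_ j \subset cls U p j.
  by apply/subsetP => y; rewrite !inE => /andP[yM ->]; rewrite (subsetP sMU).
pose f (j : 'I_s) : 'I_r := enum_val (cast_ord (esym cA) j).
have fA j : f j \in A := enum_valP _.
have f_inj : injective f by move=> j j' /enum_val_inj/cast_ord_inj.
have [||X bX X_M] := @greedy_blowup _ t eta _ (fun j => nb (M_ (f j)) x).
- move=> j; have : th <= #|M_ (f j)| by have := subsetP sAA0 _ (fA j); rewrite inE.
  have fji : f j != i by apply: contraNneq iA => <-.
  have := miss i (f j) x fji xi; have := card_nb_non (M_ (f j)) x.
  have := subset_leq_card (nonS x (sM_cls (f j))); rewrite /th; lia.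
- move=> j j' jj' y; rewrite inE => /andP[yM _].
  have jj'' : f j' != f j by rewrite (inj_eq f_inj) eq_sym.
  apply: leq_trans (miss (f j) (f j') y jj'' _); last exact: subsetP (sM_cls _) y yM.
  apply/subset_leq_card/nonS; exact: subset_trans (nb_sub _ _) (sM_cls _).
exists X => // j; have [sX ->] := X_M j; split=> //; apply: subset_trans sX (nbS _ _).
by apply/subsetP => y; rewrite inE => /andP[].
Qed.

End Groups.

Lemma linked_sub (G : sgraph) (P : {set G} -> Prop) j (U V : {set G}) :
    (forall A B : {set G}, A \subset B -> P A -> P B) ->
  U \subset V -> linked P j U -> linked P j V.
Proof.
move=> Pmono; elim: j U V => [|j IHj] U V sUV /=; first exact: Pmono.
by move=> [c cU link]; exists c; [exact: subsetP sUV c cU|exact: IHj (nbS c sUV) link].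
Qed.

Lemma balanced_cls_group (G : sgraph) (U : {set G}) r s k m q p :
    r = s + k -> 0 < s -> 0 < k -> (forall x, x \in U -> p x < r) -> m <= #|U| ->
    s * q <= m <= s * q.+1 -> k * q <= #|U| - m <= k * q.+1 ->
    \sum_(i < r) #|cls U p i| ^ 2 = balanced_sqr r #|U| ->
  exists A : {set 'I_r}, #|A| = s /\ \sum_(i in A) #|cls U p i| = m.
Proof.
move=> rE s0 k0 p_lt mU m_q b_q sumQ.
have n_q : r * q <= #|U| <= r * q.+1.
  by move: b_q; rewrite rE -{3 4}(subnKC mU); move: (#|U| - m) => b; lia.
apply: (near_constant_group rE (card_cls p_lt) _ mU m_q b_q) => i.
have [_] := sum_sqr_chord [set: 'I_r] (fun i : 'I_r => #|cls U p i|) q.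
rewrite !sum_setT cardsT card_ord sumQ (card_cls p_lt) balanced_sqrE ?rE ?addn_gt0 ?s0 -?rE //.
rewrite eqxx => /esym/forall_inP/(_ i); rewrite inE => /(_ isT)/orP[]/eqP ->; tauto.
Qed.

(* A clique on k + 1 vertices outside M would have a common neighbourhood so
   large that it contains s large parts; k of its vertices, these parts and the
   edge from the last vertex to a part form a forbidden subgraph. *)
Lemma outside_clique_free s k t L : 0 < L -> 0 < s -> 0 < k -> 0 < t -> exists n0,
  forall (G : sgraph) (U B : {set G}) a b, B \subset U -> n0 <= #|U| ->
  (forall x, x \in U -> #|non U x| <= a + 1) ->
  (forall x, x \in B -> #|non U x| <= b + 1) ->
  s * a + k * b <= #|U| -> #|U| <= L * (k * (a - b)) ->
  ~ linked (has_plus s t) k U -> ~ linked (fun=> True) k.+1 B.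
Proof.
move=> L0 s0 k0 t0; pose K := 2 * (L * k); have [n1 ES] := erdos_stone K s.-1 t.
exists (K * (n1 + s + k)) => G U B a b sBU Ubig U_non B_non abU gap nolink link.
apply: nolink; apply: (@linked_imp _ (fun V => exists2 c, c \in V & has_blowup s t (nb V c))).
  by move=> V _ [c cV]; apply: blowup_nb_plus.
apply/linkedSr/(linked_lift sBU B_non _ link) => C sCU C_big.
have K_gt0 : 0 < K by rewrite !muln_gt0 L0 k0.
have UK : 2 * #|U| <= K * (a - b) by rewrite /K; lia.
have big : n1 + s + k <= a - b by rewrite -(leq_pmul2l K_gt0); lia.
(* The k + 1 clique vertices cost (k + 1)(b + 1) of the at least s a + k b vertices of U. What
   remains beyond (s - 1)(a + 1) is about a - b, a fixed fraction of |U|, and serves as the slack in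
   [erdos_stone]. *)
have C_ge : s.-1 * (a + 1) + (a - b - (s + k)) <= #|C|.
  have : s * a = a + s.-1 * a by rewrite -mulSn prednK.
  lia.
have C_le := subset_leq_card sCU.
have : has_blowup s.-1.+1 t C.
  apply: (ES G C (a + 1)).
    by apply: leq_trans (leq_trans (leq_addl _ _) C_ge); rewrite leq_subRL; lia.
    move=> x xC; apply: leq_trans (U_non x (subsetP sCU x xC)).
    exact/subset_leq_card/nonS.
  apply: leq_trans (_ : K * (s.-1 * (a + 1) + (a - b - (s + k))) <= _); last first.
    by rewrite leq_mul2l C_ge orbT.
  rewrite [X in _ <= X]mulnDr leq_add2l mulnBr; move: UK Ubig; clearbody K; lia.
by rewrite prednK.
Qed.

Lemma linked_plus_free_bound r s k t : r = s + k -> 0 < s -> 0 < k -> 0 < t ->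
  exists n0, forall (G : sgraph) (U M : {set G}), M \subset U -> n0 <= #|U| ->
  s * #|U| <= r * #|M| -> ~ has_plus s t M -> ~ linked (has_plus s t) k U ->
  degsum U + (balanced_sqr s #|M| + balanced_sqr k (#|U| - #|M|)) <= #|U| ^ 2 /\
  (degsum U + (balanced_sqr s #|M| + balanced_sqr k (#|U| - #|M|)) = #|U| ^ 2 ->
   exists p (A : {set 'I_r}), [/\ forall x, x \in U -> p x < r,
     complete_on U p, #|A| = s & #|M| <= \sum_(i in A) #|cls U p i|]).
Proof.
move=> rE s0 k0 t0; have r0 : 0 < r by lia.
have [nr sim_r] := simonovits r0 t0; have [ns sim_s] := simonovits s0 t0.
have [L [nc col]] := plus_free_colorable r0 t0.
(* The coefficient of eta in the size condition of [plus_free_group]. *)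
pose C := r * (r * (s * t + 1)) + s.
pose L1 := L + C + 1.
have [|nk clique_free] := @outside_clique_free s k t (2 * L1) _ s0 k0 t0.
  by rewrite /L1; lia.
pose n1 := nr + r * ns + nc + nk + 2 * L1 * r + 2 * (C * r + r * r * t) + 1.
exists (n1 + n1 ^ 2).+1 => G U M sMU Ubig snm noplus nolink.
pose inv (c : {set G} * {set G}) := [/\ c.2 \subset c.1, s * #|c.1| <= r * #|c.2|,
  ~ has_plus s t c.2 & ~ linked (has_plus s t) k c.1].
pose wt (c : {set G} * {set G}) := degsum c.1 +
  (balanced_sqr s #|c.2| + balanced_sqr k (#|c.1| - #|c.2|)).
pose tight (c : {set G} * {set G}) := exists p (A : {set 'I_r}),
  [/\ forall x, x \in c.1 -> p x < r, complete_on c.1 p, #|A| = s &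
      #|c.2| <= \sum_(i in A) #|cls c.1 p i|].
apply: (@deletion_induction _ inv (fun c => #|c.1|) wt tight n1 _ _ (U, M)) => //.
  move=> [V N] [/= sNV _ _ _]; rewrite /wt /= mul2n -addnn.
  apply: leq_add; first exact: degsum_le.
  apply: leq_trans (leq_add (balanced_sqr_le _ s0) (balanced_sqr_le _ k0)) _.
  by rewrite -{2}(subnKC (subset_leq_card sNV)) sqrnD leq_addr.
have [n1_nr n1_ns n1_nc n1_nk] : [/\ nr <= n1, r * ns <= n1, nc <= n1 & nk <= n1].
  by rewrite /n1; split; lia.
have n1_L : 2 * L1 * r + 2 * (C * r + r * r * t) < n1 by rewrite /n1; lia.
have L1_C : L + C < L1 by rewrite /L1; lia.
clearbody n1 L1.
move=> {U M sMU Ubig snm noplus nolink} [U M] [/= sMU snm noplus nolink] Ubig.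
rewrite /wt /tight /=.
set n := #|U| in Ubig snm *; set m := #|M| in snm *.
have mn : m <= n := subset_leq_card sMU.
(* Deleting a vertex of M lowers r m - s n by k, so it preserves s n <= r m exactly when r m >= s n
   + k. Below that, both groups fit one balanced r-partition and [simonovits] applies to U. *)
have [bdry|far] := ltnP (r * m) (s * n + k).
  left; rewrite rE in snm bdry.
  have [q m_q b_q] := balanced_groups_boundary s0 k0 mn snm bdry.
  rewrite (balanced_sqrD s0 k0 mn m_q b_q) -rE.
  have [||le eqc] := sim_r G U; first by rewrite -/n; lia.
    by rewrite rE => /(has_plus_linked s0 t0).
  split=> // eqU; have [p p_lt p_c] := eqc eqU.
  have [|A [cA sumA]] := balanced_cls_group rE s0 k0 p_lt mn m_q b_q.
    by have := complete_degsum p_lt p_c; rewrite -eqU; apply: addnI.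
  by exists p, A; split=> //; rewrite sumA.
pose a := m %/ s; pose b := (n - m) %/ k.
have [[v vM v_low]|highM] : (exists2 v, v \in M & a + 2 <= #|non U v|) \/
    forall v, v \in M -> #|non U v| <= a + 1.
- have [/exists_inP|] := boolP [exists (v | v \in M), a + 2 <= #|non U v|].
    by left.
  rewrite negb_exists_in => /forall_inP high; right=> v /high; lia.
- right; exists (U :\ v, M :\ v); rewrite /inv /=.
  have vU := subsetP sMU v vM.
  have := cardsD1 v U; rewrite vU add1n -/n => nE.
  have := cardsD1 v M; rewrite vM add1n -/m => mE.
  split=> //.
    split; first exact: setSD.
    - by move: snm far; rewrite nE mE; lia.
    - by move=> /(has_plus_sub (subsetDl _ _)).
    - by move=> /linked_sub link; apply/nolink/link/subsetDl; apply: has_plus_sub.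
  have := balanced_sqr_succ #|M :\ v| s0; rewrite -mE (degsumD1 vU).
  have := card_nb_non U v; rewrite -/n -/a; move: v_low; rewrite nE mE subSS -!mulnn.
  by lia.
have [[v vB v_low]|highB] : (exists2 v, v \in U :\: M & b + 2 <= #|non U v|) \/
    forall v, v \in U :\: M -> #|non U v| <= b + 1.
- have [/exists_inP|] := boolP [exists (v | v \in U :\: M), b + 2 <= #|non U v|].
    by left.
  rewrite negb_exists_in => /forall_inP high; right=> v /high; lia.
- right; exists (U :\ v, M); rewrite /inv /=.
  have [vU vM] := setDP vB.
  have := cardsD1 v U; rewrite vU add1n -/n => nE.
  have sMU' : M \subset U :\ v.
    apply/subsetP => x xM; rewrite !inE (subsetP sMU) // andbT.
    by apply: contraNneq vM => <-.
  have mn' := subset_leq_card sMU'.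
  split=> //.
    split=> //; first by move: snm; rewrite nE; lia.
    by move=> /linked_sub link; apply/nolink/link/subsetDl; apply: has_plus_sub.
  have := balanced_sqr_succ (#|U :\ v| - m) k0; rewrite -subSn // -nE -/b.
  rewrite (degsumD1 vU) -/m; have := card_nb_non U v; rewrite -/n; move: v_low.
  by rewrite nE -!mulnn; lia.
left.
have am : s * a <= m by rewrite mulnC leq_trunc_div.
have bm : k * b <= n - m by rewrite mulnC leq_trunc_div.
clearbody b; have ba : b <= a.
  rewrite leq_divRL // -(leq_pmul2l k0).
  have : s * (k * b) <= s * (n - m) by rewrite leq_mul2l bm orbT.
  by move: snm; rewrite rE mulnBr; lia.
(* In the first case r a - n is at most n / (2 L1), which leaves eta = y + r small enough for
   [plus_free_group]. In the second, s a + k b <= n turns the excess r a - n into a lower bound for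
   k (a - b). *)
clearbody a; have [bal|unbal] := leqP (2 * L1 * (r * a)) ((2 * L1).+1 * n).
  have [y yE] : exists y, r * a <= n + y /\ 2 * L1 * y <= n.
    exists (r * a - n); split; first by rewrite -leq_subLR.
    by rewrite mulnBr leq_subLR addnC -mulSn.
  case: yE => ra_le Ly; have Ly' : L * y <= L1 * y by rewrite leq_mul2r; lia.
  have Cy : C * y <= L1 * y by rewrite leq_mul2r; lia.
  have LR : L * r <= L1 * r by rewrite leq_mul2r; lia.
  have CR : C * r <= L1 * r by rewrite leq_mul2r; lia.
  have non_le x : x \in U -> #|non U x| <= a + 1.
    move=> xU; have [/highM//|xM] := boolP (x \in M).
    by apply: leq_trans (highB x _) _; rewrite ?inE ?xM // leq_add2r.
  have [|//|||p p_pr] := col G U (a + 1).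
  - by rewrite -/n; lia.
  - apply: leq_trans (_ : L * (n + y + r) <= _).
      by rewrite leq_mul2l; apply/orP; right; lia.
    by rewrite -/n; lia.
  - by rewrite rE => /(has_plus_linked s0 t0).
  have [|||A cA MA] := plus_free_group sMU p_pr non_le s0 t0 _ (eta := y + r) _ snm noplus.
  - by lia.
  - by rewrite -/n; lia.
  - have -> : r * (r * (s * (t * (y + r)) + t + (y + r))) + s * (y + r) =
              C * y + C * r + r * r * t by rewrite /C; lia.
    by rewrite -/n; lia.
  have [p_lt _] := p_pr; have [le eqc] := proper_degsum p_pr.
  have m_le := card_le_group sMU MA.
  have [Qle _] := grouped_sum_sqr s0 k0 rE cA m_le (card_cls p_lt) snm.
  split; first by apply: leq_trans le; rewrite leq_add2l.
  move=> eqU; exists p, A; split=> //; apply: eqc; apply/eqP.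
  by rewrite eqn_leq le -/n -eqU leq_add2l.
pose B := U :\: M; have cB : #|B| = n - m by rewrite cardsD (setIidPr sMU).
have UE : U = M :|: B by rewrite setUC -{1}(setID U M) (setIidPr sMU) setUC.
have dMB : [disjoint M & B].
  by rewrite disjoint_sym disjoints_subset /B setDE subsetIr.
have [] := @turan_majorization G k B.
  apply: (clique_free G U B a b) => //; first exact: subsetDl.
  - by rewrite -/n; lia.
  - move=> x xU; have [/highM//|xM] := boolP (x \in M).
    by apply: leq_trans (highB x _) _; rewrite ?inE ?xM // leq_add2r.
  - by rewrite -/n -(subnKC mn) leq_add.
  - have : r * a - n <= k * (a - b).
      by rewrite mulnBr rE; lia.
    rewrite -/n -(@leq_pmul2l (2 * L1)); last by lia.
    have : 2 * L1 * (r * a - n) + 2 * L1 * n = 2 * L1 * (r * a).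
      by rewrite -mulnDr subnK // -(@leq_pmul2l (2 * L1)); lia.
    lia.
move=> p2 [p2_lt le2 eq2].
have Qk : balanced_sqr k (n - m) <= \sum_(i < k) #|cls B p2 i| ^ 2.
  rewrite -cB -sum_setT; apply: balanced_sqr_min => //; first by rewrite cardsT card_ord.
  by rewrite sum_setT card_cls.
have [|//|le1 eq1] := sim_s G M.
  rewrite -(leq_pmul2l r0); apply: leq_trans n1_ns _; apply: leq_trans Ubig _.
  by apply: leq_trans snm; rewrite leq_pmull.
have degE : degsum U = degsum M + degsum B + 2 * \sum_(x in M) #|nb B x|.
  by rewrite {1}UE degsumU.
have cross_le x : x \in M -> #|nb B x| <= #|B| ?= iff (#|nb B x| == #|B|).
  by move=> _; split=> //; apply/subset_leq_card/nb_sub.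
have [cross cross_eq] := leqif_sum cross_le; rewrite sum_nat_const in cross cross_eq.
have nE : n ^ 2 = m ^ 2 + #|B| ^ 2 + 2 * (m * #|B|) by rewrite cB -sqrnD subnKC.
rewrite -/m in cross cross_eq le1 eq1.
split; first by rewrite degE nE; lia.
rewrite degE nE => tightU.
have [|p1 p1_lt c1] := eq1; first by lia.
have c2 : complete_on B p2 by apply: eq2; lia.
have cMB x y : x \in M -> y \in B -> adj x y.
  move=> xM yB; have : \sum_(x in M) #|nb B x| == m * #|B| by apply/eqP; lia.
  rewrite cross_eq => /forall_inP/(_ x xM).
  by rewrite (subset_leqif_card (nb_sub B x)) => /subsetP/(_ y yB); rewrite inE => /andP[].
pose p x := if x \in M then p1 x else s + p2 x.
have pM x : x \in M -> p x = p1 x by rewrite /p => ->.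
have pB x : x \in B -> p x = s + p2 x by rewrite inE /p => /andP[/negPf ->].
exists p, [set i : 'I_r | i < s]; split=> [x|x y||].
- rewrite UE inE rE => /orP[xM|xB]; first by rewrite pM // ltn_addr ?p1_lt.
  by rewrite pB // ltn_add2l p2_lt.
- have pMB x' y' : x' \in M -> y' \in B -> p x' < p y'.
    by move=> xM yB; rewrite pM // pB // ltn_addr ?p1_lt.
  rewrite {1 2}UE !in_setU => /orP[xM|xB] /orP[yM|yB].
  + by rewrite !pM // c1.
  + by rewrite cMB // ltn_eqF ?pMB.
  + by rewrite adj_sym cMB // gtn_eqF ?pMB.
  + by rewrite !pB // eqn_add2l c2.
- rewrite -[RHS](@sum_ltn_ord r s) ?rE ?leq_addr // -sum1_card big_mkcond -rE.
  by apply: eq_bigr => i _; rewrite inE; case: (i < s).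
- apply: card_le_group => // x xM; have lt_r : p1 x < r by rewrite rE ltn_addr ?p1_lt.
  by exists (Ordinal lt_r); rewrite ?inE /= ?p1_lt ?pM.
Qed.

(** * Cores and embeddings *)

Lemma chi_colorable (G : sgraph) : colorable G (chi G).
Proof. by rewrite /chi; case: ex_minnP. Qed.

Lemma chi_le (G : sgraph) k : colorable G k -> chi G <= k.
Proof. by rewrite /chi; case: ex_minnP => c _ min /min. Qed.

Lemma colorable_leq (G : sgraph) k l : k <= l -> colorable G k -> colorable G l.
Proof.
move=> kl /existsP[c /forallP c_pr]; apply/existsP.
exists [ffun x => widen_ord kl (c x)]; apply/forallP => x; apply/forallP => y.
by rewrite !ffunE -val_eqE; apply: (forallP (c_pr x)).
Qed.

(** Without the critical edge x y the graph is s-colourable; if x and y got different colours, F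
    itself would be. *)
Lemma edge_critical_coloring (F : sgraph) s : edge_critical F -> chi F = s.+1 ->
  exists (c : F -> 'I_s) (x y : F), [/\ adj x y, c x = c y &
    forall u v, adj u v -> [set u; v] != [set x; y] -> c u != c v].
Proof.
move=> [x [y [xy lt_chi]]] chiF.
have /existsP[c /forallP c_pr] : colorable (del_edge x y) s.
  by apply: colorable_leq (chi_colorable _); rewrite -ltnS -chiF.
have {}c_pr u v : adj u v -> [set u; v] != [set x; y] -> c u != c v.
  by move=> uv ne; apply: (implyP (forallP (c_pr u) v)); rewrite /= /del_edge_adj uv.
exists (fun z => c z), x, y; split=> //; apply/eqP/negPn/negP => cxy.
suff : chi F <= s by rewrite chiF ltnn.
apply: chi_le; apply/existsP; exists [ffun z => c z].
apply/forallP => u; apply/forallP => v; rewrite !ffunE; apply/implyP => uv.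
have [uv_xy|] := eqVneq [set u; v] [set x; y]; last exact: c_pr.
have ux : u \in [set x; y] by rewrite -uv_xy set21.
have vx : v \in [set x; y] by rewrite -uv_xy set22.
move: ux vx uv; rewrite !inE => /orP[]/eqP-> /orP[]/eqP->; rewrite ?adj_irr //.
by rewrite eq_sym.
Qed.

(** The critical edge goes to u v and every other vertex into the part of its colour, after a
    transposition that gives x and y the colour i0. The 2 makes room for removing u and v from the
    parts. *)
Lemma edge_critical_plus (F G : sgraph) s t (U : {set G}) :
    edge_critical F -> chi F = s.+1 -> #|F| + 2 <= t -> has_plus s t U ->
  exists f : F -> G, [/\ injective f, forall x y, adj x y -> adj (f x) (f y) &
    forall x, f x \in U].
Proof.
move=> critF chiF tF [X [i0 [u [v [bX X_U [uU vU uv] uvX]]]]].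
have [c0 [x [y [xy c0xy c0_pr]]]] := edge_critical_coloring critF chiF.
pose c z := tperm (c0 x) i0 (c0 z).
have cx : c x = i0 by rewrite /c tpermL.
have cy : c y = i0 by rewrite /c -c0xy tpermL.
have c_pr z w : adj z w -> [set z; w] != [set x; y] -> c z != c w.
  by move=> zw ne; rewrite (inj_eq perm_inj) c0_pr.
pose X' i := X i :\: [set u; v].
have X'_big i : #|F| <= #|X' i|.
  have [_ tX] := X_U i; have := subset_leq_card (subsetIr (X i) [set u; v]).
  by rewrite cards2 cardsD; lia.
(* Ranks in F pick distinct vertices within a part; the parts are large enough for the default u
   never to be returned. *)
pose g z := nth u (enum (X' (c z))) (enum_rank z).
have rank_lt z : enum_rank z < size (enum (X' (c z))).
  by rewrite -cardE; apply: leq_trans (ltn_ord _) (X'_big _).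
have gX' z : g z \in X' (c z) by rewrite -mem_enum mem_nth.
have gX z : g z \in X (c z) by have := gX' z; rewrite in_setD => /andP[].
have g_new z : (g z != u) && (g z != v).
  by have := gX' z; rewrite !inE negb_or => /andP[].
have g_inj : injective g.
  move=> z w; have [czw|ne] := eqVneq (c z) (c w); last first.
    by move=> eqg; have := bX _ _ ne _ _ (gX z) (gX w); rewrite eqg adj_irr.
  rewrite /g czw => /eqP; rewrite nth_uniq ?enum_uniq -?czw //; last first.
    by rewrite czw.
  by move/eqP/val_inj/enum_rank_inj.
pose f z := if z == x then u else if z == y then v else g z.
have yx : (y == x) = false by apply: contraTF xy => /eqP->; rewrite adj_irr.
have vu : (v == u) = false by apply: contraTF uv => /eqP->; rewrite adj_irr.
have adj_x z : z != y -> adj x z -> adj u (g z).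
  move=> zy xz; apply: (uvX (c z) _ (g z) (gX z)).1.
  rewrite -cx eq_sym c_pr //; apply: contraNneq zy => /setP/(_ z).
  rewrite !inE eqxx orbT => /esym/orP[/eqP zx|//].
  by rewrite zx adj_irr in xz.
have adj_y z : z != x -> adj y z -> adj v (g z).
  move=> zx yz; apply: (uvX (c z) _ (g z) (gX z)).2.
  rewrite -cy eq_sym c_pr //; apply: contraNneq zx => /setP/(_ z).
  rewrite !inE eqxx orbT => /esym/orP[//|/eqP zy].
  by rewrite zy adj_irr in yz.
exists f; split.
- move=> z w; rewrite /f; have [/andP[/negPf zu /negPf zv] /andP[/negPf wu /negPf wv]] :=
    conj (g_new z) (g_new w).
  case: (eqVneq z x) => [->|zx]; case: (eqVneq w x) => [->|wx] //.
  + by case: eqVneq => [_ /eqP|_ /eqP]; rewrite eq_sym ?vu ?wu.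
  + by case: eqVneq => [_ /eqP|_ /eqP]; rewrite ?vu ?zu.
  case: (eqVneq z y) => [->|zy]; case: (eqVneq w y) => [->|wy] //.
  + by move/eqP; rewrite eq_sym wv.
  + by move/eqP; rewrite zv.
  exact: g_inj.
- have f_adj z w : w != x -> adj z w -> adj (f z) (f w).
    rewrite /f => /negPf wx zw; rewrite wx.
    case: (eqVneq z x) zw => [->|zx] zw.
      by case: eqVneq => [//|wy]; apply: adj_x.
    case: (eqVneq z y) zw => [->|zy] zw.
      case: eqVneq => [wy|wy]; first by rewrite wy adj_irr in zw.
      by apply: adj_y; rewrite ?wx.
    case: eqVneq => [wy|wy].
      by rewrite adj_sym; apply: adj_y; rewrite // adj_sym -wy.
    apply: (bX _ _ _ _ _ (gX z) (gX w)); apply: c_pr => //.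
    apply: contraNneq zx => /setP/(_ z); rewrite !inE eqxx (negPf zy) orbF.
    by move/esym.
  move=> z w zw; have [wx|] := eqVneq w x; last by move/f_adj; apply.
  rewrite adj_sym f_adj // ?[adj w z]adj_sym //.
  by apply: contraTneq zw => ->; rewrite wx adj_irr.
- move=> z; rewrite /f; case: eqP => // _; case: eqP => // _.
  exact: subsetP (X_U _).1 _ (gX z).
Qed.

(** The map is total on H but constrained on S only, so that vertices leave S without a change of
    type. *)
Definition embeds (H G : sgraph) (S : {set H}) (U : {set G}) : Prop :=
  exists f : H -> G, [/\ {in S &, injective f},
    {in S &, forall x y, adj x y -> adj (f x) (f y)} & {in S, forall x, f x \in U}].

(** The vertices of vs go to the clique vertices in turn; each of these is adjacent to all images
    chosen later, so every edge at it is preserved. *)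
Lemma linked_embeds (H G : sgraph) (P : {set G} -> Prop) (vs : seq H)
    (S : {set H}) (U : {set G}) :
    (forall V, P V -> embeds (S :\: [set x in vs]) V) ->
  linked P (size vs) U -> embeds S U.
Proof.
elim: vs S U => [|v vs IHvs] S U embP /=.
  by move=> /embP; rewrite set_nil setD0.
move=> [c cU link].
have [|f [f_inj f_adj f_U]] := IHvs (S :\ v) (nb U c) _ link.
  move=> V /embP; congr (embeds _ _); apply/setP => x; rewrite !inE negb_or.
  by case: (x \in S); case: (x == v); case: (x \in vs).
have fP x : x \in S -> x != v -> (f x \in U) && adj c (f x).
  by move=> xS xv; have := f_U x; rewrite !inE xv => /(_ xS).
have f_c x : x \in S -> x != v -> f x != c.
  by move=> xS xv; apply: contraTneq (fP x xS xv) => ->; rewrite adj_irr andbF.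
exists (fun x => if x == v then c else f x); split.
- move=> x y xS yS /=; case: (eqVneq x v) => [->|xv]; case: (eqVneq y v) => [->|yv] //.
  + by move/esym/eqP; rewrite (negPf (f_c y yS yv)).
  + by move/eqP; rewrite (negPf (f_c x xS xv)).
  by apply: f_inj; rewrite !inE ?xv ?yv.
- move=> x y xS yS /=; case: (eqVneq x v) => [->|xv]; case: (eqVneq y v) => [->|yv].
  + by rewrite adj_irr.
  + by case/andP: (fP y yS yv).
  + by rewrite [adj _ c]adj_sym; case/andP: (fP x xS xv).
  by apply: f_adj; rewrite !inE ?xv ?yv.
- move=> x xS; case: (eqVneq x v) => [//|xv]; by case/andP: (fP x xS xv).
Qed.

Lemma core_plus_embeds (H G : sgraph) (S : {set H}) s t (U : {set G}) :
    edge_critical (induced S) -> chi (induced S) = s.+1 -> #|H| + 2 <= t ->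
  has_plus s t U -> embeds S U.
Proof.
move=> crit chiS tH plus; have [_ [_ [u _]]] := plus.
have cS : #|induced S| + 2 <= t.
  apply: leq_trans tH; rewrite leq_add2r /= card_sub; exact: max_card.
have [f [f_inj f_adj f_U]] := edge_critical_plus crit chiS cS plus.
pose g x := if insub x is Some z then f z else u.
have gE x (xS : x \in S) : g x = f (exist _ x xS).
  by rewrite /g insubT; congr f; apply: val_inj.
exists g; split.
- by move=> x y xS yS; rewrite (gE x xS) (gE y yS) => /f_inj/(congr1 val).
- by move=> x y xS yS xy; rewrite (gE x xS) (gE y yS); apply: f_adj.
- by move=> x xS; rewrite (gE x xS).
Qed.

(** * Edge counts and the final bound *)

Lemma degsum_num_edges (G : sgraph) : degsum [set: G] = 2 * num_edges G.
Proof.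
have -> : degsum [set: G] = #|[set a : G * G | adj a.1 a.2]|.
  rewrite -sum1_card /degsum sum_setT.
  rewrite (eq_bigl (fun a : G * G => adj a.1 a.2)) => [|a]; last by rewrite inE.
  rewrite -(pair_big_dep xpredT (fun x y => adj x y) (fun _ _ => 1)) /=.
  by apply: eq_bigr => x _; rewrite -sum1_card; apply: eq_bigl => y; rewrite !inE.
rewrite -sum1_card (partition_big (fun a : G * G => [set a.1; a.2]) (mem (edges G))) /=.
  rewrite (eq_bigr (fun=> 2)) ?sum_nat_const 1?mulnC // => e.
  rewrite inE => /existsP[x /existsP[y /andP[xy /eqP ->]]].
  have neq : (x, y) != (y, x).
    rewrite xpair_eqE negb_and; apply/orP; left.
    by apply: contraTneq xy => ->; rewrite adj_irr.
  rewrite sum1_card (_ : 2 = #|[set (x, y); (y, x)]|); last by rewrite cards2 neq.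
  apply: eq_card => -[a b]; rewrite unfold_in /= !inE /= !xpair_eqE.
  apply/andP/orP => [[ab /eqP eqe]|]; last first.
    by case=> /andP[/eqP-> /eqP->]; rewrite ?[adj y x]adj_sym ?xy // setUC.
  have : a \in [set x; y] by rewrite -eqe set21.
  have : b \in [set x; y] by rewrite -eqe set22.
  rewrite !inE => /orP[]/eqP bE /orP[]/eqP aE; subst a b; rewrite ?adj_irr // in ab *.
  - by right; rewrite !eqxx.
  - by left; rewrite !eqxx.
move=> [x y]; rewrite !inE /= => xy; apply/existsP; exists x; apply/existsP; exists y.
by rewrite xy eqxx.
Qed.

(** The residue classes modulo r have the sizes that [balanced_sqr] squares and sums. *)
Lemma turan_edges r n : 0 < r -> 2 * t_ r n + balanced_sqr r n = n ^ 2.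
Proof.
move=> r0; rewrite /t_ -degsum_num_edges.
pose p (i : turan r n) := (i : 'I_n) %% r.
have p_lt (i : turan r n) : i \in [set: turan r n] -> p i < r by rewrite ltn_mod.
have := complete_degsum p_lt (fun i j _ _ => erefl (turan_adj r (i : 'I_n) j)).
rewrite cardsT card_ord => <-; congr (_ + _); apply: eq_bigr => i _; congr (_ ^ 2).
by rewrite -card_residue //; apply: eq_card => x; rewrite !inE.
Qed.

Lemma equal_parts (G : sgraph) r (p : G -> 'I_r) (A : {set 'I_r}) :
    as_equal_as_possible p A ->
  exists c, forall i, i \in A -> #|part p i| = c \/ #|part p i| = c.+1.
Proof.
move=> eqp; have [->|[i0 i0A]] := set_0Vmem A.
  by exists 0 => i; rewrite inE.
case: (arg_minnP (fun i => #|part p i|) i0A) => i iA i_min.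
exists #|part p i| => j jA; have := eqp j i jA iA; have := i_min j jA; lia.
Qed.

Lemma consecutive_equal (G : sgraph) r (p : G -> 'I_r) (A : {set 'I_r}) c :
    (forall i, i \in A -> #|part p i| = c \/ #|part p i| = c.+1) ->
  as_equal_as_possible p A.
Proof. by move=> pc i j /pc[]-> /pc[]->; lia. Qed.

Theorem corollary1 (r s : nat) (hs : 1 <= s) (hsr : s < r) (H : sgraph)
    (hH : progressive_edge_critical (r - s) H) (hchi : chi H = r.+1) :
  exists n0 : nat,
    forall (F : sgraph), is_core (r - s) H F ->
    forall (G : sgraph) (n : nat), #|G| = n -> n0 <= n -> is_free H G ->
    forall (M : {set G}) (m : nat), #|M| = m -> is_free F (induced M) ->
    (Num.ceil ((s * n)%:R / r%:R : rat) <= m%:Z)%R ->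
    num_edges G <= m * (n - m) + t_ s m + t_ (r - s) (n - m) /\
    (num_edges G = m * (n - m) + t_ s m + t_ (r - s) (n - m) <->
      exists (p : G -> 'I_r) (A : {set 'I_r}),
        complete_partite p /\
        (#|A| = s /\ \sum_(i in A) #|part p i| = m /\
          as_equal_as_possible p A) /\
        (#|~: A| = r - s /\ \sum_(i in ~: A) #|part p i| = n - m /\
          as_equal_as_possible p (~: A))).
Proof.
pose k := r - s; have k0 : 0 < k by rewrite subn_gt0.
have rE : r = s + k by rewrite subnKC // ltnW.
(* Parts of size |H| + 2 have room for F besides u and v; since this depends on H only, one n0
   serves all cores. *)
have [n0 bound] := linked_plus_free_bound rE hs k0 (isT : 0 < (#|H| + 1).+1).
exists n0 => F [vs [prog FE]] G n Gn n0n Hfree M m Mm Ffree m_ge.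
have snm : s * n <= r * m.
  move: m_ge; rewrite Num.Theory.ceil_le_int ?Num.Theory.num_real //.
  rewrite Num.Theory.ler_pdivrMr; last by rewrite Num.Theory.ltr0n; lia.
  by rewrite -pmulrn -GRing.natrM Num.Theory.ler_nat [m * r]mulnC.
have [critF chiF] : edge_critical F /\ chi F = s.+1.
  have := prog (r - s); rewrite -/k k0 leqnn => /(_ isT).
  have -> : [set x in take k vs] = [set x in vs].
    by congr [set x in _]; rewrite take_oversize // size_tuple.
  rewrite -FE hchi => -[crit chiE]; split=> //; lia.
have embF (V : {set G}) : has_plus s (#|H| + 1).+1 V -> embeds (~: [set x in vs]) V.
  move: critF chiF; rewrite FE => critF chiF.
  by apply: core_plus_embeds critF chiF _; rewrite addn1 addn2.
have cF : #|F| + 2 <= (#|H| + 1).+1.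
  by rewrite addn1 addn2 FE /= card_sub !ltnS max_card.
have noplus : ~ has_plus s (#|H| + 1).+1 M.
  move=> /(edge_critical_plus critF chiF cF)[f [f_inj f_adj f_M]]; apply: Ffree.
  exists (fun x => exist _ (f x) (f_M x)); split=> [x y /(congr1 val)/f_inj //|].
  exact: f_adj.
(* The vertices of vs would go to the k-clique, and the core into its common neighbourhood. *)
have nolink : ~ linked (has_plus s (#|H| + 1).+1) k [set: G].
  move=> link; have [||f [f_inj f_adj _]] := @linked_embeds H G
    (has_plus s (#|H| + 1).+1) vs setT setT.
  - by move=> V /embF; rewrite -setTD.
  - by rewrite size_tuple; apply: link.
  by apply: Hfree; exists f; split=> x y; [apply: (f_inj x y)|apply: (f_adj x y)]; rewrite inE.
have mn : m <= n by rewrite -Mm -Gn max_card.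
have := bound G setT M (subsetT M); rewrite cardsT Gn Mm degsum_num_edges.
case=> // le tight.
have es := turan_edges m hs; have ek := turan_edges (n - m) k0.
have nE : n ^ 2 = m ^ 2 + (n - m) ^ 2 + 2 * (m * (n - m)) by rewrite -sqrnD subnKC.
split; first by rewrite -/k; lia.
rewrite -/k; split=> [eqE|[p [A [p_c [[cA [sA eA]] [cB [sB eB]]]]]]].
  have [|q [A [q_lt q_c cA mA]]] := tight; first by lia.
  have sum_sqr := complete_degsum q_lt q_c.
  have sum_cls := card_cls q_lt; rewrite cardsT Gn in sum_sqr sum_cls.
  (* The group A may hold more than m vertices; equality allows it to be exchanged for A' with
     exactly m. *)
  have [_] := grouped_sum_sqr hs k0 rE cA mA sum_cls snm.
  rewrite degsum_num_edges in sum_sqr.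
  have q_ltT x : q x < r by apply: q_lt; rewrite inE.
  pose p x := Ordinal (q_ltT x).
  have partE i : #|part p i| = #|cls [set: G] q i|.
    by apply: eq_card => x; rewrite !inE.
  case; first by apply: (@addnI (2 * num_edges G)); rewrite [LHS]sum_sqr; lia.
  move=> A' [a [b [cA' sA' A'a A'b]]].
  exists p, A'; split; first by move=> x y; rewrite q_c ?inE.
  have sum_part : \sum_i #|part p i| = n.
    by rewrite -sum_cls; apply: eq_bigr => i _; rewrite partE.
  have sumA : \sum_(i in A') #|part p i| = m.
    by rewrite -sA'; apply: eq_bigr => i _; rewrite partE.
  split.
    by do 2!split=> //; apply: (@consecutive_equal _ _ _ _ a) => i /A'a; rewrite partE.
  split; first by have := cardsC A'; rewrite card_ord; lia.
  split; last by apply: (@consecutive_equal _ _ _ _ b) => i /A'b; rewrite partE.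
  rewrite -sumA -sum_part [in RHS](bigID (mem A')) /= addKn.
  by apply: eq_bigl => i; rewrite inE.
(* Conversely, in a complete partition with two balanced groups the squares add up to the two
   balanced sums, so the bound is attained. *)
have [a pa] := equal_parts eA; have [b pb] := equal_parts eB.
have sqrA := balanced_sqr_attained hs cA sA pa.
have sqrB := balanced_sqr_attained k0 cB sB pb.
have p_lt x : x \in [set: G] -> p x < r by [].
have := @complete_degsum G setT r (fun x => p x) p_lt (fun x y _ _ => p_c x y).
rewrite degsum_num_edges cardsT Gn.
have -> : \sum_(i < r) #|cls [set: G] (fun x => p x) i| ^ 2 =
    \sum_(i in A) #|part p i| ^ 2 + \sum_(i in ~: A) #|part p i| ^ 2.
  have partE (i : 'I_r) : #|cls [set: G] (fun x => p x) i| = #|part p i|.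
    by apply: eq_card => x; rewrite !inE.
  rewrite (bigID (mem A)) /=; congr (_ + _); first by apply: eq_bigr => i _; rewrite partE.
  by apply: eq_big => [i|i _]; rewrite ?inE ?partE.
rewrite sqrA sqrB; lia.
Qed.
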